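(* Let $N\geq 2$ and let $F\in GL_N(\mathbb C)$ satisfy $F\overline F=\varepsilon I_N$ for some $\varepsilon\in\{\pm1\}$ and $F^*F=I_N$. Let $(i,j,k)=(s+t,r+t,r+s)$ be admissible, where $r,s,t\in\mathbb N_0$. For $a\in V_i$ and $b\in V_j$, $$\|\Pi_k(ab)\|_2\leq c_{rst}\|a\|_2\|b\|_2,$$ where $$c_{rst}=\frac{\sqrt{d_{r+s}d_{r+t}d_{s+t}}}{\Theta_{rst}}.$$ The coefficient $c_{rst}$ is symmetric in $r,s,t$ and is independent of $F$ within the Kac class of fixed matrix size $N$ (that is, it depends only on $N,r,s,t$).
   Context: Let $N\ge 2$ and $F\in GL_N(\mathbb C)$ with $F\overline F=\pm I_N$ and $F^*F=I_N$ ($\overline F$ is the entrywise complex conjugate). The free orthogonal quantum group $O_F^+$ is the compact quantum group whose $C^*$-algebra $C(O_F^+)$ is the universal unital $C^*$-algebra generated by the entries of a unitary matrix $u^1=(u^1_{ij})_{1\le i,j\le N}$ subject to $u^1=F\,\overline{u^1}\,F^{-1}$, where $\overline{u^1}=((u^1_{ij})^* )$, with coproduct $\Delta(u^1_{ij})=\sum_{k}u^1_{ik}\otimes u^1_{kj}$. Since $F$ is unitary, $O_F^+$ is of Kac type: its Haar state $h$ is a trace. $L_2(O_F^+)$ is the GNS Hilbert space of $h$, with $\|x\|_2=h(x^*x)^{1/2}$. The irreducible unitary representations of $O_F^+$ are, up to equivalence, $u^k=(u^k_{ij})_{1\le i,j\le d_k}$, $k\in\mathbb N_0=\{0,1,2,\dots\}$,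 with $u^0=\mathbf 1$, $u^1$ the fundamental representation above, and fusion rules $u^i\otimes u^j\simeq u^{|i-j|}\oplus u^{|i-j|+2}\oplus\cdots\oplus u^{i+j}$. Put $V_k=\operatorname{span}\{u^k_{ij}:1\le i,j\le d_k\}$; then $L_2(O_F^+)=\bigoplus_{k\ge0}V_k$ orthogonally, and $\Pi_k$ is the orthogonal projection onto $V_k$. If $N>2$ let $q\in(0,1)$ be determined by $N=q+q^{-1}$; if $N=2$ set $q=1$. Quantum integers: $[m]=\frac{q^{-m}-q^m}{q^{-1}-q}$ if $q\neq1$, $[m]=m$ if $q=1$; $[m]!=[m][m-1]\cdots[1]$, $[0]!=1$. The dimensions are $d_k=[k+1]$ (equivalently $d_0=1$, $d_1=N$, $d_{k+1}=Nd_k-d_{k-1}$). A triple $(i,j,k)\in\mathbb N_0^3$ is admissible if $|i-j|\le k\le i+j$ and $i+j+k$ is even; equivalently $(i,j,k)=(s+t,r+t,r+s)$ with $r=\frac{j+k-i}2$, $s=\frac{i+k-j}2$, $t=\frac{i+j-k}2$ in $\mathbb N_0$. For $r,s,t\in\mathbb N_0$, $$\Theta_{rst}=\frac{[r+s+t+1]!\,[r]!\,[s]!\,[t]!}{[r+s]!\,[r+t]!\,[s+t]!}.$$ *)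

(* Defs.v *)
From HB Require Import structures.
From mathcomp Require Import all_boot all_order all_algebra.
From mathcomp Require Import spectral sesquilinear.
From mathcomp Require Import all_classical all_reals all_analysis.
From mathcomp Require Import complex mxtens.

Set Implicit Arguments.
Unset Strict Implicit.
Unset Printing Implicit Defensive.

Import Order.TTheory GRing.Theory Num.Theory.
Import numFieldNormedType.Exports.

Local Open Scope ring_scope.
Local Open Scope complex_scope.
Local Open Scope sesquilinear_scope.

(* The norm of a C*-algebra is a plain function into [R], with completeness
   spelled out, because MathComp-Analysis has no join of normed modules and
   algebras. [GRing.Algebra] excludes the zero algebra; this is immaterial for
   the universal properties below, the zero algebra being terminal. *)
HB.mixin Record isCStarAlgebra (R : realType) (A : Type)
    of GRing.Algebra R[i] A := {
  cstar : A -> A;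
  cstarD : forall x y : A, cstar (x + y) = cstar x + cstar y;
  cstarZ : forall (c : R[i]) (x : A), cstar (c *: x) = Num.conj c *: cstar x;
  cstarM : forall x y : A, cstar (x * y) = cstar y * cstar x;
  cstarK : involutive cstar;
  cnorm : A -> R;
  cnorm_eq0 : forall x : A, cnorm x = 0 -> x = 0;
  cnormD : forall x y : A, cnorm (x + y) <= cnorm x + cnorm y;
  cnormZ : forall (c : R[i]) (x : A), cnorm (c *: x) = complex.Re `|c| * cnorm x;
  cnormM : forall x y : A, cnorm (x * y) <= cnorm x * cnorm y;
  cnorm_star : forall x : A, cnorm (cstar x * x) = cnorm x ^+ 2;
  cnorm_complete : forall x : nat -> A,
    (forall e : R, 0 < e -> exists n0, forall m n,
      (n0 <= m)%N -> (n0 <= n)%N -> cnorm (x m - x n) < e) ->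
    exists l : A, forall e : R, 0 < e -> exists n0, forall n,
      (n0 <= n)%N -> cnorm (x n - l) < e
}.

#[short(type="cstarAlgType")]
HB.structure Definition CStarAlgebra (R : realType) :=
  { A of GRing.Algebra R[i] A & isCStarAlgebra R A }.

Definition star_hom (R : realType) (A B : cstarAlgType R)
    (f : {lrmorphism A -> B}) : Prop :=
  forall x, f (cstar x) = cstar (f x).

(* [f] and [g] induce an embedding of the algebraic tensor product of [A] and
   [B] as a *-subalgebra of [T], [a (x) b] being sent to [f a * g b]. *)
Definition tensor_embedding (R : realType) (A B T : cstarAlgType R)
    (f : {lrmorphism A -> T}) (g : {lrmorphism B -> T}) : Prop :=
  [/\ star_hom f, star_hom g,
      forall a b, f a * g b = g b * f a
    & forall n (a : 'I_n -> A) (b : 'I_n -> B),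
        (forall c : 'I_n -> R[i], \sum_i c i *: a i = 0 -> forall i, c i = 0) ->
        \sum_i f (a i) * g (b i) = 0 -> forall i, b i = 0].

(* [T] is the completion of the algebraic tensor product of [A] and [B] for
   the least C*-norm. *)
Definition minimal_tensor (R : realType) (A B T : cstarAlgType R)
    (f : {lrmorphism A -> T}) (g : {lrmorphism B -> T}) : Prop :=
  [/\ tensor_embedding f g,
      forall (x : T) (e : R), 0 < e ->
        exists n (a : 'I_n -> A) (b : 'I_n -> B),
          cnorm (x - \sum_i f (a i) * g (b i)) < e
    & forall (T' : cstarAlgType R)
        (f' : {lrmorphism A -> T'}) (g' : {lrmorphism B -> T'}),
        tensor_embedding f' g' ->
        forall n (a : 'I_n -> A) (b : 'I_n -> B),
          cnorm (\sum_i f (a i) * g (b i)) <= cnorm (\sum_i f' (a i) * g' (b i))].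

Definition scalar_entries (R : realType) (A : cstarAlgType R) m n
    (M : 'M[R[i]]_(m, n)) : 'M[A]_(m, n) :=
  map_mx (in_alg A) M.

Definition adjoint_mx (R : realType) (A : cstarAlgType R) m n
    (v : 'M[A]_(m, n)) : 'M[A]_(n, m) :=
  (map_mx cstar v)^T.

Definition unitary_over (R : realType) (A : cstarAlgType R) n
    (v : 'M[A]_n) : Prop :=
  adjoint_mx v *m v = 1%:M /\ v *m adjoint_mx v = 1%:M.

Definition free_orthogonal_relations (R : realType) N (F : 'M[R[i]]_N)
    (A : cstarAlgType R) (u : 'M[A]_N) : Prop :=
  unitary_over u /\
  u = scalar_entries A F *m map_mx cstar u *m scalar_entries A (invmx F).

(* The compact quantum group O_F^+: the C*-algebra C(O_F^+) with its
   generating matrix, and its coproduct into the minimal tensor square. All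
   these data are unique up to isomorphism, and coassociativity and the
   cancellation properties follow from the formula for the coproduct. *)
Record freeOrthogonal (R : realType) N (F : 'M[R[i]]_N) := FreeOrthogonal {
  fo_alg :> cstarAlgType R;
  fo_gen : 'M[fo_alg]_N;
  fo_relations : free_orthogonal_relations F fo_gen;
  fo_universal : forall (B : cstarAlgType R) (v : 'M[B]_N),
    free_orthogonal_relations F v ->
    (exists f : {lrmorphism fo_alg -> B},
      star_hom f /\ map_mx f fo_gen = v) /\
    (forall f g : {lrmorphism fo_alg -> B},
      star_hom f -> star_hom g ->
      map_mx f fo_gen = v -> map_mx g fo_gen = v -> f =1 g);
  fo_tensor : cstarAlgType R;
  fo_inl : {lrmorphism fo_alg -> fo_tensor};
  fo_inr : {lrmorphism fo_alg -> fo_tensor};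
  fo_tensorP : minimal_tensor fo_inl fo_inr;
  fo_coprod : {lrmorphism fo_alg -> fo_tensor};
  fo_coprod_star : star_hom fo_coprod;
  fo_coprod_gen : forall i j,
    fo_coprod (fo_gen i j) = \sum_k fo_inl (fo_gen i k) * fo_inr (fo_gen k j)
}.

Section QuantumGroup.
Variables (R : realType) (N : nat) (F : 'M[R[i]]_N) (G : freeOrthogonal F).

(* [E] is the bounded slice map [h (x) id]; it is determined by [h]. *)
Definition left_slice (h : {scalar G}) (E : {linear fo_tensor G -> G}) : Prop :=
  (exists M : R, forall x, cnorm (E x) <= M * cnorm x) /\
  (forall a b, E (fo_inl G a * fo_inr G b) = h a *: b).

(* [E] is the bounded slice map [id (x) h]. *)
Definition right_slice (h : {scalar G}) (E : {linear fo_tensor G -> G}) : Prop :=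
  (exists M : R, forall x, cnorm (E x) <= M * cnorm x) /\
  (forall a b, E (fo_inl G a * fo_inr G b) = h b *: a).

Record haar_state (h : {scalar G}) : Prop := HaarState {
  haar_ge0 : forall x : G, 0 <= h (cstar x * x);
  haar1 : h 1 = 1;
  haar_left : exists2 E, left_slice h E &
    forall x, E (fo_coprod G x) = (h x)%:A;
  haar_right : exists2 E, right_slice h E &
    forall x, E (fo_coprod G x) = (h x)%:A
}.

Definition unitary_rep n (v : 'M[G]_n) : Prop :=
  unitary_over v /\
  forall i j, fo_coprod G (v i j) = \sum_k fo_inl G (v i k) * fo_inr G (v k j).

(* A subspace of C^n is the range of an idempotent [P]; it is invariant under
   [v] iff [v P = P v P]. *)
Definition irreducible n (v : 'M[G]_n) : Prop :=
  (0 < n)%N /\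
  forall P : 'M[R[i]]_n, P *m P = P ->
    v *m scalar_entries G P = scalar_entries G P *m v *m scalar_entries G P ->
    P = 0 \/ P = 1%:M.

Definition equivalent m n (v : 'M[G]_m) (w : 'M[G]_n) : Prop :=
  exists S : 'M[R[i]]_(n, m),
    [/\ S ^t* *m S = 1%:M, S *m S ^t* = 1%:M
      & scalar_entries G S *m v = w *m scalar_entries G S].

(* The labelling (u^k) of the irreducible unitary representations. In the
   fusion rules the labels |i-j|, |i-j|+2, .., i+j are |i-j|+2l for
   0 <= l <= min(i,j). *)
Record irreps := Irreps {
  irr_dim : nat -> nat;
  irr_mx : forall k, 'M[G]_(irr_dim k);
  irr_rep : forall k, unitary_rep (irr_mx k);
  irr_irreducible : forall k, irreducible (irr_mx k);
  irr_complete : forall n (v : 'M[G]_n), unitary_rep v -> irreducible v ->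
    exists k, equivalent v (irr_mx k);
  irr_inequivalent : forall k l, equivalent (irr_mx k) (irr_mx l) -> k = l;
  irr_trivial : equivalent (irr_mx 0) (1%:M : 'M[G]_1);
  irr_fundamental : equivalent (irr_mx 1) (fo_gen G);
  irr_fusion : forall i j,
    equivalent (tensmx (irr_mx i) (irr_mx j))
      (mxdiag (fun l : 'I_(minn i j).+1 =>
         irr_mx ((maxn i j - minn i j) + 2 * l)))
}.

Definition coeff_space (u : irreps) k : set G :=
  [set x | exists c : 'M[R[i]]_(irr_dim u k),
    x = \sum_i \sum_j c i j *: irr_mx u k i j].

Definition norm2 (h : {scalar G}) (x : G) : R[i] := sqrtC (h (cstar x * x)).

(* GNS Hilbert space of [h]. In [{dot H for Num.conj}] forms are linear in
   the first argument, so that <Lx, Ly> = h(y* x). *)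
Record gns (h : {scalar G}) := Gns {
  gns_space :> completeNormedModType R[i];
  gns_form : {dot gns_space for Num.conj};
  gns_norm : forall x, gns_form x x = `|x| ^+ 2;
  gns_map : {linear G -> gns_space};
  gns_mapE : forall x y, gns_form (gns_map x) (gns_map y) = h (cstar y * x);
  gns_dense : dense (range gns_map)
}.

Definition orthogonal_projection (h : {scalar G}) (H : gns h) (W : set H)
    (P : H -> H) : Prop :=
  forall x, W (P x) /\ forall w, W w -> gns_form H (x - P x) w = 0.

End QuantumGroup.

Section QuantumIntegers.
Variable R : realType.

Definition quantum_parameter (N : nat) (q : R) : Prop :=
  if (2 < N)%N then 0 < q < 1 /\ N%:R = q + q^-1 else q = 1.

Definition qint (q : R) (m : nat) : R :=
  if q == 1 then m%:R else (q ^- m - q ^+ m) / (q^-1 - q).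

Definition qfact (q : R) (m : nat) : R := \prod_(1 <= l < m.+1) qint q l.

Definition theta (q : R) (r s t : nat) : R :=
  (qfact q (r + s + t + 1) * qfact q r * qfact q s * qfact q t) /
  (qfact q (r + s) * qfact q (r + t) * qfact q (s + t)).

Definition crst (q : R) (d : nat -> nat) (r s t : nat) : R :=
  Num.sqrt ((d (r + s)%N)%:R * (d (r + t)%N)%:R * (d (s + t)%N)%:R) /
  theta q r s t.

End QuantumIntegers.

Definition kac_parameter (R : realType) N (F : 'M[R[i]]_N) : Prop :=
  [/\ F \in unitmx,
      exists2 eps : R[i], eps = 1 \/ eps = -1 &
        F *m map_mx Num.conj F = eps%:M
    & F ^t* *m F = 1%:M].

(* Main.v *)
Require Import Defs.
From HB Require Import structures.
From mathcomp Require Import all_boot all_order all_algebra.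
From mathcomp Require Import spectral sesquilinear.
From mathcomp Require Import all_classical all_reals all_analysis.
From mathcomp Require Import complex mxtens.
From mathcomp Require Import ring zify.

Set Implicit Arguments.
Unset Strict Implicit.
Unset Printing Implicit Defensive.

Import Order.TTheory GRing.Theory Num.Theory.
Import numFieldNormedType.Exports.

(** Write [T'] for the adjoint of [T]. The irreducible [u^k] is carried by an
    isometric intertwiner [W_k] from [C^(d_k)] to the [k]-th tensor power of
    [C^N], whose range is the space of tensors killed by all contractions with
    [F]; hence [W_k W_k'] is the Jones-Wenzl projection of the Temperley-Lieb
    calculus generated by [F]. For [(i, j, k) = (s + t, r + t, r + s)] consider
    the intertwiner [X = (W_i (x) W_j)' (1_s (x) cup_t (x) 1_r) W_k], where
    [cup_t] is the tensor of [t] nested copies of [F]. By Wenzl's recursion each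
    cup multiplies [X' X] by an explicit ratio of quantum integers, and
    [X' X = Theta_rst / d_k]. As [u^k] occurs once in [u^i (x) u^j], every
    intertwiner between them is a multiple of [X], so invariance of the Haar
    state expresses [h((u^k)' u^i u^j)] as [X (x) conj X / Theta_rst]. Finally
    [X] contracts three orthonormal families along bundles of [s], [t] and [r]
    strands (this is where unitarity of [F] enters), so that two applications of
    Cauchy-Schwarz bound the trilinear form by a product of Hilbert-Schmidt
    norms, each of which is [sqrt d] times an [L_2] norm. *)

(** The Jones-Wenzl projection is needed in two guises: Wenzl's recursion yields the numbers, the
    isometries [W_k] yield the representations. They are matched only through what characterises the
    projection: it fixes whatever the caps kill and vanishes on cups. That [W_k] reaches every
    tensor killed by the caps is proved along with its construction from
    [u^1 (x) u^(k+1) = u^(k+2) + u^k]: on this space the first cap detects exactly the summand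
    [u^k].

    The calculus takes the dimension [d_(m-1)] for [[m]], as it needs only the recursion and
    nonvanishing; [q] is met only when the product of ratios is compared with [Theta_rst].

    The form to be estimated contains [X] and its conjugate at once, with coefficients indexed by
    pairs that need not factor. As [X (x) conj X] is again a contraction of three orthonormal
    families, over doubled bundles, the same estimate applies. Its denominator is [d_k] from Schur
    orthogonality times [X' X], that is, [Theta_rst]. Finally the projection [c] of [ab] is tested
    against itself: [||c||^2 = h(c' a b)] with [c'] the adjoint, and one factor [||c||] cancels. *)

Local Open Scope ring_scope.

(** * Temperley-Lieb calculus *)

Section TemperleyLieb.
Variables (K : fieldType) (V : lmodType K) (cup cap : nat -> {linear V -> V}).
Variables (delta eps : K) (D : nat -> K).
Hypothesis eps2 : eps * eps = 1.
Hypothesis cap_cup : forall i f, cap i (cup i f) = delta *: f.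
Hypothesis cap_cupS : forall i f, cap i (cup i.+1 f) = eps *: f.
Hypothesis capS_cup : forall i f, cap i.+1 (cup i f) = eps *: f.
Hypothesis cup_cup : forall i j f, (j <= i)%N ->
  cup j (cup i f) = cup i.+2 (cup j f).
Hypothesis cap_cup_left : forall i j f, (j <= i)%N ->
  cap i.+2 (cup j f) = cup j (cap i f).
Hypothesis cap_cup_right : forall i j f, (j <= i)%N ->
  cap j (cup i.+2 f) = cup i (cap j f).
Hypothesis cap_cap : forall i j f, (j <= i)%N ->
  cap i (cap j f) = cap j (cap i.+2 f).
Hypothesis D0 : D 0 = 0.
Hypothesis D1 : D 1 = 1.
Hypothesis DSS : forall m, D m.+2 = delta * D m.+1 - D m.
Hypothesis D_neq0 : forall m, D m.+1 != 0.

(* Jones-Wenzl projection on the m strands a, .., a + m - 1; D m stands for the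
   quantum integer [m]. At the first step the truncated index (a + 0).-1 is
   harmless because D 0 = 0. *)
Fixpoint jw_rec a m (f : V) : V :=
  if m is m'.+1 then
    jw_rec a m' f - (D m' / D m) *:
      jw_rec a m' (cup (a + m').-1 (cap (a + m').-1 (jw_rec a m' f)))
  else f.
(** Locked so that simplification does not unfold the branching recursion. *)
Definition jw := locked jw_rec.

Lemma jw0 a f : jw a 0 f = f.
Proof. by rewrite /jw -lock. Qed.

Lemma jwS a m f : jw a m.+1 f = jw a m f - (D m / D m.+1) *:
  jw a m (cup (a + m).-1 (cap (a + m).-1 (jw a m f))).
Proof. by rewrite /jw -lock. Qed.

Lemma jw1 a f : jw a 1 f = f.
Proof. by rewrite jwS D0 mul0r scale0r subr0 jw0. Qed.

Lemma jwSS a m f : jw a m.+2 f = jw a m.+1 f - (D m.+1 / D m.+2) *: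
  jw a m.+1 (cup (a + m) (cap (a + m) (jw a m.+1 f))).
Proof. by rewrite jwS addnS. Qed.

Lemma jw_is_linear a m : linear (jw a m).
Proof.
elim: m => [|m IH] k f g; rewrite ?jw0 // !jwS IH linearP linearP IH scalerBr scalerDr.
by rewrite !scalerA [k * _]mulrC opprD addrACA.
Qed.
HB.instance Definition _ a m :=
  GRing.isLinear.Build K V V *:%R (jw a m) (jw_is_linear a m).

Lemma jw_cup_right a m j f : (a + m <= j)%N ->
  jw a m (cup j f) = cup j (jw a m f).
Proof.
elim: m j f => [|[|m] IH] j f Hj; rewrite ?(jw0, jw1) //.
rewrite !jwSS !linearB !linearZ /= (IH j f) //; last by lia.
have [j' Ej] : exists j', j = j'.+2 by exists j.-2; lia.
rewrite {j}Ej in Hj *.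
rewrite cap_cup_right; last by lia.
rewrite cup_cup; last by lia.
by rewrite IH //; lia.
Qed.

(** The block moves from [a] to [a.+2] because [cup j] inserts two strands to its left. *)
Lemma jw_cup_left a m j f : (j <= a)%N ->
  jw a.+2 m (cup j f) = cup j (jw a m f).
Proof.
elim: m j f => [|[|m] IH] j f Hj; rewrite ?(jw0, jw1) //.
rewrite !jwSS !linearB !linearZ /= (IH j f) //.
rewrite !addSn cap_cup_left; last by lia.
by rewrite -cup_cup ?IH //; lia.
Qed.

Lemma cap_jw_right a m j f : (a + m <= j)%N ->
  cap j (jw a m f) = jw a m (cap j f).
Proof.
elim: m j f => [|[|m] IH] j f Hj; rewrite ?(jw0, jw1) //.
rewrite !jwSS !linearB !linearZ /= !(IH j) //; try lia.
have [j' Ej] : exists j', j = j'.+2 by exists j.-2; lia.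
rewrite {j}Ej in Hj *.
rewrite cap_cup_left; last by lia.
rewrite cap_cap; last by lia.
by rewrite IH //; lia.
Qed.

Lemma cap_jw_left a m j f : (j <= a)%N ->
  cap j (jw a.+2 m f) = jw a m (cap j f).
Proof.
elim: m j f => [|[|m] IH] j f Hj; rewrite ?(jw0, jw1) //.
rewrite !jwSS !linearB !linearZ /= !(IH j) //.
rewrite !addSn cap_cup_right; last by lia.
by rewrite -cap_cap ?IH //; lia.
Qed.

Lemma jw_comm a m b n f : (a + m <= b)%N ->
  jw a m (jw b n f) = jw b n (jw a m f).
Proof.
elim: n f => [|[|n] IH] f Hb; rewrite ?(jw0, jw1) //.
rewrite [in LHS]jwSS [in RHS]jwSS !linearB !linearZ /= !IH //.
rewrite jw_cup_right; last by lia.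
by rewrite -cap_jw_right ?IH //; lia.
Qed.

Lemma jw_id a m f :
  (forall i, (a <= i)%N -> (i.+1 < a + m)%N -> cap i f = 0) -> jw a m f = f.
Proof.
elim: m => [|[|m] IH] Hf; rewrite ?(jw0, jw1) //.
rewrite jwSS IH => [|i ? ?]; last by rewrite Hf //; lia.
by rewrite Hf ?(linear0, scaler0, subr0) //; lia.
Qed.

(** Dual to [jw_id]: once [Q] absorbs the shorter projection, it meets the cup of the correction
    term directly. Together the two lemmas let any operator be recognised as [jw]. *)
Lemma jw_absorb (Q : {linear V -> V}) a m f :
  (forall i g, (a <= i)%N -> (i.+1 < a + m)%N -> Q (cup i g) = 0) ->
  Q (jw a m f) = Q f.
Proof.
elim: m f => [|[|m] IH] f HQ; rewrite ?(jw0, jw1) //.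
have HQ' i g : (a <= i)%N -> (i.+1 < a + m.+1)%N -> Q (cup i g) = 0.
  by move=> ? ?; rewrite HQ //; lia.
rewrite jwSS linearB linearZ /= !IH //.
by rewrite HQ ?(linear0, scaler0, subr0) //; lia.
Qed.

Lemma D_ratio m : delta - D m / D m.+1 = D m.+2 / D m.+1.
Proof. by rewrite DSS; field; exact: D_neq0. Qed.

Lemma eps_ratio m : (delta - eps * eps * (D m / D m.+1) = D m.+2 / D m.+1) *
  (delta - D m / D m.+1 * eps * eps = D m.+2 / D m.+1).
Proof. by rewrite -[_ * eps * eps]mulrA !eps2 mul1r mulr1 D_ratio. Qed.

(** Closing the last strand: the leading term of the recursion gives a loop [delta], the correction
    straightens out through two zigzags with [eps * eps = 1]. Idempotency is a hypothesis because
    the lemma is applied inside the induction that provides it. *)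
Lemma right_trace a m f : (forall g, jw a m (jw a m g) = jw a m g) ->
  cap (a + m) (jw a m.+1 (cup (a + m) f)) = (D m.+2 / D m.+1) *: jw a m f.
Proof.
case: m => [|m] Hm.
  by rewrite addn0 !jw1 jw0 cap_cup DSS D0 D1 mulr1 subr0 divr1.
rewrite jwSS linearB linearZ /= jw_cup_right; last by lia.
rewrite cap_cup addnS cap_cupS linearZ /= cap_jw_right; last by lia.
by rewrite capS_cup !linearZ /= Hm ?scalerN !scalerA -scalerBl eps_ratio.
Qed.

(** Only the last cap or cup of the block is new. The coefficient of the recursion is the inverse of
    the partial trace in [right_trace], so the two terms cancel. The induction is strong because
    that trace requires idempotency two steps back. *)
Lemma jw_kill a m :
  (forall i f, (a <= i)%N -> (i.+1 < a + m)%N -> cap i (jw a m f) = 0) /\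
  (forall i f, (a <= i)%N -> (i.+1 < a + m)%N -> jw a m (cup i f) = 0).
Proof.
have [n] := ubnP m; elim: n m => // n IH [|[|m]] Hm.
- by split=> i f; lia.
- by split=> i f; lia.
have [IHl IHr] := IH m.+1 Hm.
have [IHl' IHr'] := IH m (ltnW Hm).
have idem g : jw a m (jw a m g) = jw a m g by apply: jw_id => i *; exact: IHl'.
have pp g : jw a m (jw a m.+1 g) = jw a m.+1 g.
  by apply: jw_id => i *; rewrite IHl //; lia.
have pp' g : jw a m.+1 (jw a m g) = jw a m.+1 g.
  by apply: jw_absorb => i h * /=; rewrite IHr //; lia.
have cc : D m.+1 / D m.+2 * (D m.+2 / D m.+1) = 1.
  by field; rewrite !D_neq0.
split=> i f ai im; rewrite jwSS.
  rewrite linearB linearZ /=.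
  have [im'|im'] := ltnP i.+1 (a + m.+1).
    by rewrite !(IHl i) // scaler0 subr0.
  have -> : i = (a + m)%N by lia.
  by rewrite right_trace // -cap_jw_right // pp scalerA cc scale1r subrr.
have [im'|im'] := ltnP i.+1 (a + m.+1).
  by rewrite (IHr i) // ?(linear0, scaler0, subr0).
have -> : i = (a + m)%N by lia.
rewrite right_trace // !linearZ /= -jw_cup_right //.
by rewrite pp' scalerA cc scale1r subrr.
Qed.

Lemma cap_jw a m i f : (a <= i)%N -> (i.+1 < a + m)%N -> cap i (jw a m f) = 0.
Proof. exact: (proj1 (jw_kill a m)). Qed.

Lemma jw_cup a m i f : (a <= i)%N -> (i.+1 < a + m)%N -> jw a m (cup i f) = 0.
Proof. exact: (proj2 (jw_kill a m)). Qed.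

Lemma jw_jw a m b n f : (a <= b)%N -> (b + n <= a + m)%N ->
  jw a m (jw b n f) = jw a m f.
Proof. by move=> ? ?; apply: jw_absorb => i g * /=; rewrite jw_cup //; lia. Qed.

Lemma jw_jw' a m b n f : (a <= b)%N -> (b + n <= a + m)%N ->
  jw b n (jw a m f) = jw a m f.
Proof. by move=> ? ?; apply: jw_id => i *; rewrite cap_jw //; lia. Qed.

(* Both sides are annihilated by caps and absorb cups, so their product equals
   either of them. *)
Lemma left_wenzl a m f : jw a m.+1 f = jw a.+1 m f - (D m / D m.+1) *:
   jw a.+1 m (cup a (cap a (jw a.+1 m f))).
Proof.
elim: m a f => [|m IH] a f; first by rewrite jw1 jw0 D0 mul0r scale0r subr0.
have tr g : cap a (jw a.+1 m.+1 (cup a g)) = (D m.+2 / D m.+1) *: jw a m g.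
  rewrite IH linearB linearZ /= jw_cup_left // cap_cup cap_jw_left //.
  rewrite cap_cupS capS_cup !linearZ /= jw_jw //.
  by rewrite ?scalerN !scalerA -scalerBl eps_ratio.
set q := RHS.
have Hq : jw a m.+2 q = q.
  apply: jw_id => i ai im; rewrite linearB linearZ /=.
  have [e|e] := eqVneq i a; last first.
    by rewrite !(@cap_jw _ _ i) ?(scaler0, subr0) //; lia.
  rewrite e tr -cap_jw_left // jw_jw' //; last by lia.
  rewrite scalerA mulrA divfK ?D_neq0 // divff ?D_neq0 // scale1r subrr.
  by [].
rewrite -Hq linearB linearZ /= !jw_jw //; try lia.
by rewrite jw_cup ?(scaler0, subr0) //; lia.
Qed.

Lemma left_trace a m f :
  cap a (jw a.+1 m.+1 (cup a f)) = (D m.+2 / D m.+1) *: jw a m f.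
Proof.
rewrite left_wenzl linearB linearZ /= jw_cup_left // cap_cup cap_jw_left //.
rewrite cap_cupS capS_cup !linearZ /= jw_jw //.
by rewrite ?scalerN !scalerA -scalerBl eps_ratio.
Qed.

Lemma D_add m n : D (m + n).+1 = D m.+1 * D n.+1 - D m * D n.
Proof.
have [k] := ubnP m; elim: k m => // k IH [|[|m]] Hk.
- by rewrite D0 D1 add0n; ring.
- by rewrite add1n !DSS D0 D1; ring.
have E1 := IH m.+1 Hk; have E0 := IH m (ltnW Hk).
by rewrite !addSn DSS -addSn E1 E0 !DSS; ring.
Qed.

(* Multiplying the ratios for l < t gives Theta_rst / [r + s + 1]. *)
Definition vertex_ratio r s t : K :=
  D (r + s + t).+2 * D t.+1 / (D (s + t).+1 * D (r + t).+1).

Lemma vertex_ratio0 r s : vertex_ratio r s 0 = D (r + s).+2 / (D s.+1 * D r.+1).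
Proof. by rewrite /vertex_ratio !addn0 D1 mulr1. Qed.

(** This is the recursion that [cap_jw_cup] produces for [m = (s + t).+1] and [n = (r + t).+1]; the
    addition formula [D_add] shows that the closed form satisfies it. *)
Lemma vertex_ratioS r s t : vertex_ratio r s t.+1 =
  (D (r + s + t + t).+4 + D (s + t).+1 * D (r + t).+1 * vertex_ratio r s t)
   / (D (s + t).+2 * D (r + t).+2).
Proof.
rewrite /vertex_ratio !addnS; set x := D _; rewrite [_ * (_ / _)]mulrC divfK; last first.
  by rewrite mulf_neq0 ?D_neq0.
congr (_ / _).
have -> : (r + s + t + t).+4 = ((r + s + t).+2 + t.+1).+1 by lia.
by rewrite D_add /x; ring.
Qed.

(** * Evaluation of the theta network *)

Section Theta.
Variables (r s : nat).

(** Each cup is inserted between the legs of the previous one, which nests them; [caps] removes them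
    from the inside out. *)
Fixpoint cups t (f : V) : V := if t is t'.+1 then cup (s + t') (cups t' f) else f.
Fixpoint caps t (f : V) : V := if t is t'.+1 then caps t' (cap (s + t') f) else f.

Definition vertex t (f : V) : V :=
  jw 0 (s + t) (jw (s + t) (r + t) (cups t (jw 0 (r + s) f))).

Lemma vertex0 f : vertex 0 f = jw 0 (r + s) f.
Proof.
rewrite /vertex /= !addn0 (@jw_jw' 0 (r + s) s r) ?(@jw_jw' 0 (r + s) 0 s) //; lia.
Qed.

(** The longer projections absorb the shorter ones inside [vertex t], so a vertex can be built one
    cup at a time. *)
Lemma vertexS t f : vertex t.+1 f =
  jw 0 (s + t).+1 (jw (s + t).+1 (r + t).+1 (cup (s + t) (vertex t f))).
Proof.
rewrite /vertex /= !addnS -(@jw_cup_right 0) // -(@jw_comm 0) //.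
by rewrite (@jw_jw 0 _ 0) // -jw_cup_left // (@jw_jw (s + t).+1) //; lia.
Qed.

Lemma jw_vertex_l t f : jw 0 (s + t) (vertex t f) = vertex t f.
Proof. by rewrite /vertex jw_jw. Qed.

Lemma jw_vertex_r t f : jw (s + t) (r + t) (vertex t f) = vertex t f.
Proof. by rewrite /vertex -jw_comm // (@jw_jw (s + t)). Qed.

(** The left projection is expanded at its right end and the right one at its left end. Terms whose
    zigzags straighten give multiples of [f], gathered by [D_add]; what remains is the same picture
    with the cup and cap one place to the left, ready for an induction. The truncated index [m.-1]
    is harmless: at [m = 0] its coefficient vanishes. *)
Lemma cap_jw_cup m n f : jw 0 m f = f -> jw m n f = f ->
  cap m (jw 0 m.+1 (jw m.+1 n.+1 (cup m f))) =
    (D (m + n).+2 / (D m.+1 * D n.+1)) *: f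
    + (D m * D n / (D m.+1 * D n.+1)) *: jw 0 m (jw m n (cup m.-1 (cap m.-1 f))).
Proof.
case: m => [|m] fm fn.
  by rewrite jw1 left_trace fn D0 D1 !mul0r scale0r addr0 mul1r.
case: n fn => [|n] fn.
  rewrite jw1 -[m.+1]add0n (right_trace (a := 0)) => [|g]; last by rewrite jw_jw.
  by rewrite fm addn0 D0 D1 !(mulr0, mul0r) scale0r addr0 mulr1.
set Y := jw _ _ (cup _ _).
have E1 : cap m.+1 Y = (D n.+3 / D n.+2) *: f by rewrite left_trace fn.
have E2 : jw 0 m.+1 Y = Y by rewrite /Y jw_comm // jw_cup_right // fm.
have E3 : cap m Y = eps *: jw m n.+2 f.
  by rewrite /Y cap_jw_left // cap_cupS linearZ.
rewrite jwS E2 add0n linearB linearZ /= E1 E3 cap_jw_right // capS_cup.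
rewrite !linearZ /= scalerA [jw m _ f]left_wenzl fn linearB linearZ /= fm.
rewrite [jw 0 m.+1 (_ *: _)]linearZ /= !scalerN !scalerBr opprB !scalerA.
rewrite addrA addrAC -scalerBl.
have -> : eps * (D m.+1 / D m.+2 * eps) = D m.+1 / D m.+2.
  by rewrite [_ * eps]mulrC mulrA eps2 mul1r.
congr (_ *: _ + _ *: _); last by field; rewrite !D_neq0.
have -> : (m.+1 + n.+1).+2 = (m.+1 + n.+2).+1 by lia.
by rewrite D_add; field; rewrite !D_neq0.
Qed.

(** The remainder in [cap_jw_cup] contains [cap] of the previous vertex, known by induction, and
    then rebuilds [vertex] through [vertexS]. At the start it vanishes: either [D 0 = 0] occurs or
    the cap falls inside the projection on [r + s] strands. *)
Lemma cap_vertex t f : cap (s + t) (vertex t.+1 f) = vertex_ratio r s t *: vertex t f.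
Proof.
elim: t => [|t IH]; rewrite vertexS cap_jw_cup ?jw_vertex_l ?jw_vertex_r //.
  rewrite vertex0 vertex_ratio0 !addn0 [(s + r)%N]addnC.
  have [->|s0] := posnP s; first by rewrite D0 !mul0r scale0r addr0.
  have [->|r0] := posnP r; first by rewrite D0 mulr0 !mul0r scale0r addr0.
  by rewrite cap_jw ?linear0 ?scaler0 ?addr0 //; lia.
rewrite !addnS /= IH !linearZ /= -vertexS scalerA -scalerDl vertex_ratioS.
have -> : ((s + t).+1 + (r + t)).+3 = (r + s + t + t).+4 by lia.
by rewrite mulrDl [vertex_ratio r s t * _]mulrC [_ * vertex_ratio r s t / _]mulrAC.
Qed.

Lemma caps_linear t : linear (caps t).
Proof. by elim: t => [//|t IH] k f g /=; rewrite linearP IH. Qed.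
HB.instance Definition _ t := GRing.isLinear.Build K V V *:%R (caps t) (caps_linear t).

Lemma caps_vertex t f :
  caps t (vertex t f) = (\prod_(l < t) vertex_ratio r s l) *: jw 0 (r + s) f.
Proof.
elim: t => [|t IH]; first by rewrite big_ord0 scale1r -vertex0.
rewrite /= cap_vertex linearZ /= IH big_ord_recr /= scalerA.
by rewrite mulrC.
Qed.

End Theta.
End TemperleyLieb.

(** * Contractions of orthonormal families *)

Section Estimates.
Variable C : numClosedFieldType.

Lemma cauchy_schwarz_sum (I : Type) (r : seq I) (f g : I -> C) :
  `|\sum_(i <- r) f i * g i| ^+ 2 <=
  (\sum_(i <- r) `|f i| ^+ 2) * (\sum_(i <- r) `|g i| ^+ 2).
Proof.
set s := \sum_(i <- r) f i * g i; set a := \sum_(i <- r) _; set b := \sum_(i <- r) _.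
have sE : s^* = \sum_(i <- r) (f i * g i)^* by rewrite rmorph_sum.
(* Lagrange's identity *)
have key : \sum_(i <- r) \sum_(j <- r) `|f i * (g j)^* - f j * (g i)^*| ^+ 2 =
    (a * b - `|s| ^+ 2) *+ 2.
  have -> : (a * b - `|s| ^+ 2) *+ 2 = a * b + b * a - (s * s^* + s^* * s).
    by rewrite normCK; ring.
  rewrite {1}/a {2}/b {1}/s {2}sE !mulr_suml -!big_split -sumrB.
  apply: eq_bigr => i _ /=.
  rewrite /a /b sE /s !mulr_sumr -!big_split -sumrB.
  apply: eq_bigr => j _ /=.
  by rewrite !normCK !(rmorphB, rmorphM) /= !conjCK; ring.
rewrite -subr_ge0 -(pmulrn_lge0 _ (isT : 0 < 2)%N) -key.
by apply: sumr_ge0 => i _; apply: sumr_ge0 => j _; exact: exprn_ge0.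
Qed.

Lemma parseval_sum (I : finType) (T : Type) (r : seq T) (P : I -> T -> C) A :
  (forall i j, \sum_(y <- r) P i y * (P j y)^* = (i == j)%:R) ->
  \sum_(y <- r) `|\sum_i A i * P i y| ^+ 2 = \sum_i `|A i| ^+ 2.
Proof.
move=> ortho.
transitivity (\sum_i \sum_j A i * (A j)^* * \sum_(y <- r) P i y * (P j y)^*).
  under [RHS]eq_bigr => i _ do
    (under eq_bigr => j _ do rewrite mulr_sumr; rewrite exchange_big).
  rewrite [RHS]exchange_big; apply: eq_bigr => y _ /=.
  rewrite normCK rmorph_sum mulr_suml; apply: eq_bigr => i _.
  by rewrite mulr_sumr; apply: eq_bigr => j _; rewrite rmorphM /=; ring.
apply: eq_bigr => i _; rewrite (bigD1 i) //= [X in _ + X]big1 => [|j ne].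
  by rewrite ortho eqxx mulr1 addr0 normCK.
by rewrite ortho eq_sym (negPf ne) mulr0.
Qed.

(** Cauchy-Schwarz over the pairs [(y, x)] separates [c]; a second use over [z], for each pair, is
    submultiplicativity of the Hilbert-Schmidt norm. *)
Lemma triangle_bound (T1 T2 T3 : Type) (r1 : seq T1) (r2 : seq T2) (r3 : seq T3)
    (a : T1 -> T2 -> C) (b : T2 -> T3 -> C) (c : T1 -> T3 -> C) :
  `|\sum_(y <- r1) \sum_(x <- r3) (\sum_(z <- r2) a y z * b z x) * c y x| ^+ 2 <=
  (\sum_(y <- r1) \sum_(z <- r2) `|a y z| ^+ 2) *
  (\sum_(z <- r2) \sum_(x <- r3) `|b z x| ^+ 2) *
  (\sum_(y <- r1) \sum_(x <- r3) `|c y x| ^+ 2).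
Proof.
have := cauchy_schwarz_sum [seq (y, x) | y <- r1, x <- r3]
  (fun p => \sum_(z <- r2) a p.1 z * b z p.2) (fun p => c p.1 p.2).
rewrite !big_allpairs => /le_trans; apply; apply: ler_wpM2r.
  by do 2![apply: sumr_ge0 => ? _]; exact: exprn_ge0.
rewrite [X in _ * X]exchange_big mulr_suml; apply: ler_sum => y _.
rewrite mulr_sumr; apply: ler_sum => x _; exact: cauchy_schwarz_sum.
Qed.

Section Triangle.
Variables (I J K : finType) (T1 T2 T3 : Type).
Variables (r1 : seq T1) (r2 : seq T2) (r3 : seq T3).
Variables (P : I -> T1 -> T2 -> C) (Q : J -> T2 -> T3 -> C) (S : K -> T1 -> T3 -> C).

Definition orthonormal2 (I0 : finType) (U1 U2 : Type) (s1 : seq U1) (s2 : seq U2)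
    (f : I0 -> U1 -> U2 -> C) :=
  forall i j, \sum_(y <- s1) \sum_(z <- s2) f i y z * (f j y z)^* = (i == j)%:R.

Lemma parseval2 (I0 : finType) (U1 U2 : Type) (s1 : seq U1) (s2 : seq U2)
    (f : I0 -> U1 -> U2 -> C) A : orthonormal2 s1 s2 f ->
  \sum_(y <- s1) \sum_(z <- s2) `|\sum_i A i * f i y z| ^+ 2 = \sum_i `|A i| ^+ 2.
Proof.
move=> ortho.
have := @parseval_sum I0 _ [seq (y, x) | y <- s1, x <- s2] (fun i p => f i p.1 p.2) A.
by rewrite big_allpairs => -> // i j; rewrite big_allpairs ortho.
Qed.

Hypotheses (Po : orthonormal2 r1 r2 P) (Qo : orthonormal2 r2 r3 Q).
Hypothesis So : orthonormal2 r1 r3 S.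

Definition trivalent i j k :=
  \sum_(y <- r1) \sum_(x <- r3) (\sum_(z <- r2) P i y z * Q j z x) * S k y x.

(** The coefficients are summed into the families first. By Parseval the resulting three matrices
    have the Hilbert-Schmidt norms of [A], [B] and [D], and [triangle_bound] applies. *)
Lemma trivalent_bound (A : I -> C) (B : J -> C) (D : K -> C) :
  `|\sum_i \sum_j \sum_k A i * B j * D k * trivalent i j k| ^+ 2 <=
  (\sum_i `|A i| ^+ 2) * (\sum_j `|B j| ^+ 2) * (\sum_k `|D k| ^+ 2).
Proof.
rewrite -(parseval2 A Po) -(parseval2 B Qo) -(parseval2 D So).
apply: le_trans (triangle_bound _ _ _ _ _ _).
rewrite le_eqVlt; apply/orP; left; apply/eqP; congr (`|_| ^+ 2).
rewrite /trivalent.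
under eq_bigr => i _ do under eq_bigr => j _ do under eq_bigr => k _ do
  (rewrite mulr_sumr; under eq_bigr => y _ do rewrite mulr_sumr).
under eq_bigr => i _ do under eq_bigr => j _ do
  (rewrite exchange_big; under eq_bigr => y _ do rewrite exchange_big).
under eq_bigr => i _ do
  (rewrite exchange_big; under eq_bigr => y _ do rewrite exchange_big).
rewrite exchange_big; apply: eq_bigr => y _ /=.
rewrite exchange_big; apply: eq_bigr => x _ /=.
transitivity (\sum_i \sum_j A i * B j * (\sum_(z <- r2) P i y z * Q j z x) *
    \sum_k D k * S k y x).
  apply: eq_bigr => i _; apply: eq_bigr => j _; rewrite mulr_sumr.
  by apply: eq_bigr => k _; ring.
under [LHS]eq_bigr => i _ do rewrite -mulr_suml.
rewrite -mulr_suml; congr (_ * _).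
under [LHS]eq_bigr => i _ do (under eq_bigr => j _ do rewrite mulr_sumr; rewrite exchange_big).
rewrite exchange_big; apply: eq_bigr => z _ /=; rewrite mulr_suml.
apply: eq_bigr => i _; rewrite mulr_sumr; apply: eq_bigr => j _; ring.
Qed.

End Triangle.

Section Doubling.
Variables (I J K : finType) (T1 T2 T3 : Type).
Variables (r1 : seq T1) (r2 : seq T2) (r3 : seq T3).
Variables (P : I -> T1 -> T2 -> C) (Q : J -> T2 -> T3 -> C) (S : K -> T1 -> T3 -> C).

(** The family [f (x) conj f] over doubled bundles. A coefficient of [u^k] carries a row and a
    column index, one attached to [X] and the other to its conjugate. *)
Definition dbl (I0 U1 U2 : Type) (f : I0 -> U1 -> U2 -> C)
    (i : I0 * I0) (y : U1 * U1) (z : U2 * U2) :=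
  f i.1 y.1 z.1 * (f i.2 y.2 z.2)^*.

Notation sq r := [seq (x, y) | x <- r, y <- r].

Lemma sum_sq (T : Type) (r : seq T) (f g : T -> C) :
  \sum_(x <- sq r) f x.1 * g x.2 = (\sum_(x <- r) f x) * (\sum_(x <- r) g x).
Proof.
rewrite big_allpairs mulr_suml; apply: eq_bigr => x _ /=.
by rewrite mulr_sumr.
Qed.

Lemma orthonormal_dbl (I0 : finType) (U1 U2 : Type) (s1 : seq U1) (s2 : seq U2)
    (f : I0 -> U1 -> U2 -> C) :
  orthonormal2 s1 s2 f -> orthonormal2 (sq s1) (sq s2) (dbl f).
Proof.
move=> fo [i i'] [j j']; rewrite xpair_eqE -mulnb natrM -!fo.
have E : (i' == j')%:R = \sum_(y <- s1) (\sum_(z <- s2) (f i' y z)^* * f j' y z) :> C.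
  rewrite -fo; have <- : ((\sum_(y <- s1) \sum_(z <- s2) f i' y z * (f j' y z)^*)^*) =
     \sum_(y <- s1) \sum_(z <- s2) f i' y z * (f j' y z)^* by rewrite fo conjC_nat.
  rewrite rmorph_sum; apply: eq_bigr => y _; rewrite rmorph_sum; apply: eq_bigr => z _.
  by rewrite rmorphM /= conjCK.
rewrite (fo i' j') E -sum_sq; apply: eq_bigr => y _; rewrite -sum_sq.
by apply: eq_bigr => z _; rewrite /dbl rmorphM /= conjCK mulrACA.
Qed.

Hypotheses (Po : orthonormal2 r1 r2 P) (Qo : orthonormal2 r2 r3 Q).
Hypothesis So : orthonormal2 r1 r3 S.
Notation X := (trivalent r1 r2 r3 P Q S).

Lemma trivalent_dbl i j k :
  trivalent (sq r1) (sq r2) (sq r3) (dbl P) (dbl Q) (dbl S) i j k =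
  X i.1 j.1 k.1 * (X i.2 j.2 k.2)^*.
Proof.
rewrite /trivalent rmorph_sum -sum_sq; apply: eq_bigr => y _ /=.
rewrite rmorph_sum -sum_sq; apply: eq_bigr => x _ /=.
rewrite rmorphM rmorph_sum mulrACA -sum_sq; congr (_ * _).
by apply: eq_bigr => z _; rewrite /dbl rmorphM /= mulrACA.
Qed.

Lemma trivalent_bound2 (A : I * I -> C) (B : J * J -> C) (D : K * K -> C) :
  `|\sum_i \sum_j \sum_k A i * B j * D k * (X i.1 j.1 k.1 * (X i.2 j.2 k.2)^*)| ^+ 2 <=
  (\sum_i `|A i| ^+ 2) * (\sum_j `|B j| ^+ 2) * (\sum_k `|D k| ^+ 2).
Proof.
have := trivalent_bound (orthonormal_dbl Po) (orthonormal_dbl Qo) (orthonormal_dbl So) A B D.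
by under eq_bigr => i _ do under eq_bigr => j _ do under eq_bigr => k _ do
  rewrite trivalent_dbl.
Qed.

End Doubling.
End Estimates.

(** * Tensors as functions of infinite words *)

Section Streams.
Variables (T : Type).
Implicit Types (w : nat -> T) (a b : T).

Definition ins2 i a b w : nat -> T := fun n =>
  if (n < i)%N then w n else if n == i then a else if n == i.+1 then b else w n.-2.
Definition del2 i w : nat -> T := fun n => if (n < i)%N then w n else w n.+2.
Definition upd i a w : nat -> T := fun n => if n == i then a else w n.

Ltac stream_cases := apply/funext => n; rewrite /ins2 /del2 /upd /=;
  do ?[case: ifPn => ?]; try lia; try reflexivity; try (congr (_ _); lia).

Lemma ins2_at i a b w : (ins2 i a b w i = a) * (ins2 i a b w i.+1 = b).
Proof.
by rewrite /ins2 ltnn eqxx ltnNge ltnW //= eqxx gtn_eqF.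
Qed.

Lemma upd_id i w : upd i (w i) w = w.
Proof. by apply/funext => n; rewrite /upd; case: eqP => // ->. Qed.

Lemma del2_lt i n w : (n < i)%N -> del2 i w n = w n.
Proof. by rewrite /del2 => ->. Qed.

Lemma del2_ge i n w : (i <= n)%N -> del2 i w n = w n.+2.
Proof. by rewrite /del2 ltnNge => ->. Qed.

Lemma ins2_lt i n a b w : (n < i)%N -> ins2 i a b w n = w n.
Proof. by rewrite /ins2 => ->. Qed.

Lemma ins2_ge i n a b w : (i <= n)%N -> ins2 i a b w n.+2 = w n.
Proof. by move=> ?; rewrite /ins2 ifN ?ifN ?ifN //; lia. Qed.

Lemma del_ins i a b w : del2 i (ins2 i a b w) = w.
Proof. stream_cases. Qed.

Lemma delS_ins i a b w : del2 i.+1 (ins2 i a b w) = upd i a w.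
Proof. stream_cases. Qed.

Lemma del_insS i a b w : del2 i (ins2 i.+1 a b w) = upd i b w.
Proof. stream_cases. Qed.

Lemma del_del i j w : (j <= i)%N -> del2 i (del2 j w) = del2 j (del2 i.+2 w).
Proof. move=> ?; stream_cases. Qed.

Lemma del_ins_left i j a b w : (j <= i)%N ->
  del2 j (ins2 i.+2 a b w) = ins2 i a b (del2 j w).
Proof. move=> ?; stream_cases. Qed.

Lemma del_ins_right i j a b w : (j <= i)%N ->
  del2 i.+2 (ins2 j a b w) = ins2 j a b (del2 i w).
Proof. move=> ?; stream_cases. Qed.

Lemma ins_ins i j a b c d w : (j <= i)%N ->
  ins2 j a b (ins2 i c d w) = ins2 i.+2 c d (ins2 j a b w).
Proof. move=> ?; stream_cases. Qed.

End Streams.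

(* Tensors of arbitrary length are modelled as functions of infinite words, so
   that inserting and deleting letters is total and the Temperley-Lieb relations
   hold without length conditions. *)
Section StreamTL.
Variables (K : fieldType) (N : nat) (F F' : 'M[K]_N) (delta eps : K).
Hypothesis FF' : F *m F' = eps%:M.
Hypothesis trFF' : \sum_a \sum_b F' a b * F a b = delta.

Notation V := ((nat -> 'I_N) -> K^o).

Definition scup i (f : V) : V := fun w => F (w i) (w i.+1) * f (del2 i w).
Definition scap i (f : V) : V := fun w => \sum_a \sum_b F' a b * f (ins2 i a b w).

Lemma scup_linear i : linear (scup i).
Proof.
by move=> k f g; apply/funext => w; rewrite /scup !fctE mulrDr /GRing.scale /= mulrCA.
Qed.
HB.instance Definition _ i := GRing.isLinear.Build K V V *:%R (scup i) (scup_linear i).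

Lemma scap_linear i : linear (scap i).
Proof.
move=> k f g; apply/funext => w; rewrite /scap !fctE scaler_sumr -big_split.
apply: eq_bigr => a _; rewrite scaler_sumr -big_split; apply: eq_bigr => b _ /=.
by rewrite mulrDr /GRing.scale /= mulrCA.
Qed.
HB.instance Definition _ i := GRing.isLinear.Build K V V *:%R (scap i) (scap_linear i).

Lemma scap_scup i f : scap i (scup i f) = delta *: f.
Proof.
apply/funext => w; rewrite /scap /scup !fctE -trFF' scaler_suml.
apply: eq_bigr => a _; rewrite scaler_suml; apply: eq_bigr => b _.
by rewrite !ins2_at del_ins mulrA.
Qed.

Hypothesis eps2 : eps * eps = 1.

(** A one-sided inverse of a square matrix is two-sided, so both zigzags carry the same sign. *)
Lemma mulF'F : F' *m F = eps%:M.
Proof.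
have : F *m (eps *: F') = 1%:M by rewrite -scalemxAr FF' scale_scalar_mx eps2.
move/mulmx1C; rewrite -scalemxAl => /(congr1 (fun M => eps *: M)).
by rewrite scalerA eps2 scale1r scalemx1.
Qed.

Lemma scap_scupS i f : scap i (scup i.+1 f) = eps *: f.
Proof.
apply/funext => w; rewrite /scap /scup !fctE.
transitivity (\sum_a (F' *m F) a (w i) * f (upd i a w)).
  apply: eq_bigr => a _; rewrite mxE mulr_suml; apply: eq_bigr => b _.
  by rewrite delS_ins ins2_at /ins2 ltnNge leqW //= gtn_eqF // gtn_eqF // mulrA.
rewrite mulF'F (bigD1 (w i)) //= big1 => [|a /negPf ne].
  by rewrite upd_id mxE eqxx addr0.
by rewrite mxE ne mul0r.
Qed.

Lemma scapS_scup i f : scap i.+1 (scup i f) = eps *: f.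
Proof.
apply/funext => w; rewrite /scap /scup !fctE exchange_big.
transitivity (\sum_b (F *m F') (w i) b * f (upd i b w)).
  apply: eq_bigr => b _; rewrite mxE mulr_suml; apply: eq_bigr => a _.
  by rewrite del_insS ins2_at /ins2 ltnSn mulrA [F' _ _ * _]mulrC.
rewrite FF' (bigD1 (w i)) //= big1 => [|b ne].
  by rewrite upd_id mxE eqxx addr0.
by rewrite mxE eq_sym (negPf ne) mul0r.
Qed.

Lemma scup_scup i j f : (j <= i)%N -> scup j (scup i f) = scup i.+2 (scup j f).
Proof.
move=> ji; apply/funext => w; rewrite /scup del_del // mulrCA.
by rewrite !(@del2_ge _ j) ?(leqW ji) // !(@del2_lt _ i.+2) // ltnS leqW.
Qed.

Lemma scap_scup_left i j f : (j <= i)%N ->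
  scap i.+2 (scup j f) = scup j (scap i f).
Proof.
move=> ji; apply/funext => w; rewrite /scap /scup mulr_sumr.
apply: eq_bigr => a _; rewrite mulr_sumr; apply: eq_bigr => b _.
by rewrite del_ins_left // mulrCA !ins2_lt // ltnS leqW.
Qed.

Lemma scap_scup_right i j f : (j <= i)%N ->
  scap j (scup i.+2 f) = scup i (scap j f).
Proof.
move=> ji; apply/funext => w; rewrite /scap /scup mulr_sumr.
apply: eq_bigr => a _; rewrite mulr_sumr; apply: eq_bigr => b _.
by rewrite del_ins_right // mulrCA !ins2_ge // leqW.
Qed.

Lemma scap_scap i j f : (j <= i)%N -> scap i (scap j f) = scap j (scap i.+2 f).
Proof.
move=> ji; apply/funext => w; rewrite /scap.
under eq_bigr => a _ do under eq_bigr => b _ do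
  (rewrite mulr_sumr; under eq_bigr => c _ do rewrite mulr_sumr).
under [RHS]eq_bigr => a _ do under eq_bigr => b _ do
  (rewrite mulr_sumr; under eq_bigr => c _ do rewrite mulr_sumr).
under eq_bigr => a _ do rewrite exchange_big.
rewrite exchange_big; apply: eq_bigr => c _.
under eq_bigr => a _ do rewrite exchange_big.
rewrite exchange_big; apply: eq_bigr => d _.
by do 2![apply: eq_bigr => ? _]; rewrite mulrCA ins_ins.
Qed.

End StreamTL.

(** * Intertwiners *)

Local Open Scope complex_scope.
Local Open Scope sesquilinear_scope.

Section StarAlgebra.
Variables (R : realType) (A : cstarAlgType R).
Notation C := R[i].
Notation sc := (@scalar_entries R A _ _).

Lemma cstar0 : cstar (0 : A) = 0.
Proof. by apply: (@addrI _ (cstar 0)); rewrite -cstarD !addr0. Qed.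

Lemma cstar_sum I (r : seq I) (P : pred I) (f : I -> A) :
  cstar (\sum_(i <- r | P i) f i) = \sum_(i <- r | P i) cstar (f i).
Proof. exact: (big_morph _ (@cstarD _ A) cstar0). Qed.

Lemma cstar1 : cstar (1 : A) = 1.
Proof. by rewrite -[LHS]mul1r -[X in X * _]cstarK -cstarM mul1r cstarK. Qed.

Lemma mul_scalar_entriesE m n p (M : 'M[C]_(m, n)) (v : 'M[A]_(n, p)) i j :
  (sc M *m v) i j = \sum_k M i k *: v k j.
Proof. by rewrite mxE; apply: eq_bigr => k _; rewrite mxE mulr_algl. Qed.

Lemma mulmx_scalar_entriesE m n p (v : 'M[A]_(m, n)) (M : 'M[C]_(n, p)) i j :
  (v *m sc M) i j = \sum_k M k j *: v i k.
Proof. by rewrite mxE; apply: eq_bigr => k _; rewrite mxE mulr_algr. Qed.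

Lemma scalar_entriesM m n p (M : 'M[C]_(m, n)) (M' : 'M[C]_(n, p)) :
  sc (M *m M') = sc M *m sc M'.
Proof. exact: map_mxM. Qed.

Lemma scalar_entries1 n : sc (1%:M : 'M[C]_n) = 1%:M.
Proof. exact: map_mx1. Qed.

Lemma mul_scalar_entries_scalar m n c (v : 'M[A]_(m, n)) :
  sc c%:M *m v = \matrix_(i, j) (c *: v i j).
Proof.
apply/matrixP => i j; rewrite mul_scalar_entriesE mxE (bigD1 i) //= big1 => [|k ne].
  by rewrite mxE eqxx addr0.
by rewrite mxE eq_sym (negPf ne) scale0r.
Qed.

Lemma scalar_entries_comm m n c (v : 'M[A]_(m, n)) : sc c%:M *m v = v *m sc c%:M.
Proof.
rewrite mul_scalar_entries_scalar; apply/matrixP => i j.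
rewrite mulmx_scalar_entriesE mxE (bigD1 j) //= big1 => [|k ne].
  by rewrite mxE eqxx addr0.
by rewrite mxE (negPf ne) scale0r.
Qed.

Lemma adjoint_mxM m n p (v : 'M[A]_(m, n)) (w : 'M[A]_(n, p)) :
  adjoint_mx (v *m w) = adjoint_mx w *m adjoint_mx v.
Proof.
apply/matrixP => i j; rewrite !mxE cstar_sum; apply: eq_bigr => k _.
by rewrite !mxE cstarM.
Qed.

Lemma adjoint_scalar_entries m n (M : 'M[C]_(m, n)) : adjoint_mx (sc M) = sc (M ^t*).
Proof. by apply/matrixP => i j; rewrite !mxE cstarZ cstar1. Qed.

Definition intertwiner m n (v : 'M[A]_m) (w : 'M[A]_n) (T : 'M[C]_(n, m)) :=
  sc T *m v = w *m sc T.

Lemma intertwiner_comp m n p (v : 'M[A]_m) (w : 'M[A]_n) (z : 'M[A]_p) T S :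
  intertwiner w z S -> intertwiner v w T -> intertwiner v z (S *m T).
Proof. by rewrite /intertwiner !scalar_entriesM => S_ T_; rewrite -mulmxA T_ !mulmxA S_. Qed.

Lemma intertwinerZ m n (v : 'M[A]_m) (w : 'M[A]_n) T c :
  intertwiner v w T -> intertwiner v w (c *: T).
Proof.
move=> /matrixP E; apply/matrixP => i j; move: (E i j).
rewrite !mul_scalar_entriesE !mulmx_scalar_entriesE => /(congr1 (fun x => c *: x)).
by rewrite !scaler_sumr; under eq_bigr do rewrite scalerA;
  under [in RHS]eq_bigr do rewrite scalerA;
  move=> E'; under eq_bigr do rewrite mxE; under [in RHS]eq_bigr do rewrite mxE.
Qed.

(** The adjoint of the relation involves the adjoints of [v] and [w]; unitarity moves them to the
    other sides. *)
Lemma intertwiner_adj m n (v : 'M[A]_m) (w : 'M[A]_n) T :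
  unitary_over v -> unitary_over w -> intertwiner v w T ->
  intertwiner w v (T ^t*).
Proof.
move=> [_ vv] [ww _] E; have := congr1 (@adjoint_mx R A _ _) E.
rewrite !adjoint_mxM !adjoint_scalar_entries => E'.
rewrite /intertwiner -[LHS]mul1mx -vv -mulmxA; congr (_ *m _).
by rewrite mulmxA E' -mulmxA ww mulmx1.
Qed.

(** Inverting [S] on both sides suffices; this serves block sums and tensor products, whose
    unitarity is not at hand. *)
Lemma intertwiner_unitary m n (v : 'M[A]_m) (w : 'M[A]_n) S :
  S ^t* *m S = 1%:M -> S *m S ^t* = 1%:M -> intertwiner v w S ->
  intertwiner w v (S ^t*).
Proof.
move=> S1 S2 E; rewrite /intertwiner -[LHS]mulmx1 -scalar_entries1 -S2 scalar_entriesM !mulmxA.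
by rewrite -[_ *m w *m _]mulmxA -E !mulmxA -scalar_entriesM S1 scalar_entries1 mul1mx.
Qed.

End StarAlgebra.

Section Schur.
Variables (R : realType) (N : nat) (F : 'M[R[i]]_N) (G : freeOrthogonal F).
Notation C := R[i].
Notation sc := (@scalar_entries R G _ _).

(* If a is an eigenvalue of T and X a generalized inverse of T - a, then
   1 - X (T - a) is an idempotent onto the eigenspace, which is invariant. *)
Lemma schur n (v : 'M[G]_n) T : irreducible v -> intertwiner v v T ->
  exists c, T = c%:M.
Proof.
move=> [n0 irr] vT; have [a eig] := eigenvalue_closed T n0.
pose T' := T - a%:M; exists a.
have vT' : intertwiner v v T'.
  rewrite /intertwiner /scalar_entries raddfB /= mulmxBl mulmxBr vT.
  by congr (_ - _); rewrite scalar_entries_comm.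
pose X := pinvmx T'.
have TXT : T' *m X *m T' = T' by apply: mulmxKpV.
pose P := 1%:M - X *m T'.
have TP : T' *m P = 0 by rewrite mulmxBr mulmx1 mulmxA TXT subrr.
have PP : P *m P = P.
  by rewrite {1}/P mulmxBl mul1mx -mulmxA TP mulmx0 subr0.
have inv : v *m sc P = sc P *m v *m sc P.
  have E : sc T' *m (v *m sc P) = 0.
    by rewrite mulmxA vT' -mulmxA -scalar_entriesM TP /scalar_entries map_mx0 mulmx0.
  have scP : sc P = 1%:M - sc X *m sc T'.
    by rewrite /scalar_entries raddfB /= map_mx1 map_mxM.
  by rewrite -mulmxA {2}scP mulmxBl mul1mx -mulmxA E mulmx0 subr0.
have [P0|P1] := irr P PP inv.
- have XT : X *m T' = 1%:M by apply/eqP; rewrite eq_sym -subr_eq0 -P0.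
  move: eig; rewrite /eigenvalue /eigenspace kermx_eq0 row_free_unit -/T'.
  by case/negP; apply/(proj2 (mulmx1_unit XT)).
- have XT : X *m T' = 0.
    by apply: (@addrI _ P); rewrite addr0 subrK P1.
  by apply/eqP; rewrite -subr_eq0 -/T' -TXT -mulmxA XT mulmx0.
Qed.
End Schur.

Lemma sum_mxtens (V : nmodType) m n (f : 'I_(m * n) -> V) :
  \sum_k f k = \sum_i \sum_j f (mxtens_index (i, j)).
Proof.
rewrite pair_big (reindex (@mxtens_index m n)) /=.
  by apply: eq_bigr => -[].
by exists (@mxtens_unindex m n) => k _; rewrite (mxtens_indexK, mxtens_unindexK).
Qed.

Section TensorIntertwiners.
Variables (R : realType) (A : cstarAlgType R).
Notation C := R[i].
Notation sc := (@scalar_entries R A _ _).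

Lemma intertwiner_tens m n m' n' (v : 'M[A]_m) (w : 'M[A]_n) (v' : 'M[A]_m')
    (w' : 'M[A]_n') T T' :
  intertwiner v w T -> intertwiner v' w' T' ->
  intertwiner (tensmx v v') (tensmx w w') (tensmx T T').
Proof.
move=> /matrixP E /matrixP E'; apply/matrixP => a b.
case: (mxtens_indexP a) => i i'; case: (mxtens_indexP b) => j j'.
have := congr2 *%R (E i j) (E' i' j').
rewrite !mul_scalar_entriesE !mulmx_scalar_entriesE !sum_mxtens !mulr_suml => eqE.
transitivity (\sum_(k < m) T i k *: v k j * \sum_(k < m') T' i' k *: v' k j').
  apply: eq_bigr => k _; rewrite mulr_sumr; apply: eq_bigr => k' _.
  by rewrite !tensmxE -scalerAl -scalerAr scalerA.
rewrite eqE; apply: eq_bigr => k _; rewrite mulr_sumr; apply: eq_bigr => k' _.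
by rewrite !tensmxE -scalerAl -scalerAr scalerA.
Qed.

Lemma adj_tens m n p q (S : 'M[C]_(m, n)) (T : 'M[C]_(p, q)) :
  (tensmx S T) ^t* = tensmx (S ^t*) (T ^t*).
Proof. by apply/matrixP => i j; rewrite !mxE rmorphM. Qed.

Lemma tensmx_id m n : tensmx (1%:M : 'M[C]_m) (1%:M : 'M[C]_n) = 1%:M.
Proof.
apply/matrixP => a b.
case: (mxtens_indexP a) => i i'; case: (mxtens_indexP b) => j j'.
rewrite tensmxE !mxE -natrM mulnb; congr (_%:R); congr nat_of_bool.
by rewrite (inj_eq (can_inj (@mxtens_indexK m n))).
Qed.

Lemma intertwiner1 n (v : 'M[A]_n) : intertwiner v v 1%:M.
Proof. by rewrite /intertwiner scalar_entries1 mul1mx mulmx1. Qed.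

End TensorIntertwiners.

(** * Multiplicities, fusion rules and dimensions *)

Section Irreducibles.
Variables (R : realType) (N : nat) (F : 'M[R[i]]_N) (G : freeOrthogonal F).
Variable (u : irreps G).
Notation C := R[i].
Notation sc := (@scalar_entries R G _ _).
Notation d := (irr_dim u).

Lemma irr_dim_gt0 k : (0 < d k)%N.
Proof. by case: (irr_irreducible u k). Qed.

Lemma sqnorm_col m n (T : 'M[C]_(m, n)) j :
  (T ^t* *m T) j j = \sum_i `|T i j| ^+ 2.
Proof. by rewrite mxE; apply: eq_bigr => i _; rewrite !mxE mulrC normCK. Qed.

(** By Schur, [T' T] and [T T'] are scalars; they agree because [T] is nonzero, and positivity
    allows rescaling [T] by the inverse square root to a unitary. *)
Lemma equivalent_of_intertwiner k l (T : 'M[C]_(d l, d k)) :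
  intertwiner (irr_mx u k) (irr_mx u l) T -> T != 0 ->
  equivalent (irr_mx u k) (irr_mx u l).
Proof.
move=> TE T0.
have TE' := intertwiner_adj (irr_rep u k).1 (irr_rep u l).1 TE.
have [c cE] := schur (irr_irreducible u k) (intertwiner_comp TE' TE).
have [c' cE'] := schur (irr_irreducible u l) (intertwiner_comp TE TE').
have [[i j] Tij] : exists ij, T ij.1 ij.2 != 0.
  apply/existsP; apply: contraNT T0 => /existsPn T0; apply/eqP/matrixP => i j.
  by have := T0 (i, j); rewrite negbK mxE => /eqP.
have c0 : 0 < c.
  have <- : (T ^t* *m T) j j = c by rewrite cE mxE eqxx.
  rewrite sqnorm_col (bigD1 i) //=; apply: ltr_wpDr.
    by apply: sumr_ge0 => *; rewrite exprn_ge0.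
  by rewrite exprn_gt0 // normr_gt0.
have cc' : c' = c.
  have : c' *: T = c *: T by rewrite -mul_scalar_mx -cE' -mulmxA cE mul_mx_scalar.
  by move/matrixP/(_ i j); rewrite !mxE; apply: mulIf.
pose s := (sqrtC c)^-1.
have ss : s^* * s * c = 1.
  have s0 : 0 <= s by rewrite invr_ge0 sqrtC_ge0 ltW.
  rewrite conj_Creal ?ger0_real // -expr2 exprVn sqrtCK mulVf //.
  by rewrite gt_eqF.
have sT : (s *: T) ^t* = s^* *: T ^t*.
  by apply/matrixP => ? ?; rewrite !mxE rmorphM.
exists (s *: T); rewrite sT; split; last exact: intertwinerZ.
- by rewrite -scalemxAr -scalemxAl scalerA cE scale_scalar_mx [s * _]mulrC ss.
- by rewrite -scalemxAr -scalemxAl scalerA cE' cc' scale_scalar_mx ss.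
Qed.

Lemma schur_neq k l (T : 'M[C]_(d l, d k)) :
  intertwiner (irr_mx u k) (irr_mx u l) T -> k != l -> T = 0.
Proof.
move=> TE; apply: contraNeq => T0; apply/eqP.
exact: irr_inequivalent (equivalent_of_intertwiner TE T0).
Qed.

(** A direct sum given by its coisometries. Both directions of intertwining are recorded, since
    without unitarity of [w] one does not follow from the other by [intertwiner_adj]. *)
Record decomposition n (w : 'M[G]_n) m (lab : 'I_m -> nat)
    (S : forall l, 'M[C]_(d (lab l), n)) : Prop := Decomposition {
  decomp_to : forall l, intertwiner w (irr_mx u (lab l)) (S l);
  decomp_from : forall l, intertwiner (irr_mx u (lab l)) w ((S l) ^t*);
  decomp_iso : forall l, S l *m (S l) ^t* = 1%:M;
  decomp_sum : \sum_l (S l) ^t* *m S l = 1%:M }.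

Lemma decomposition_mxdiag n (w : 'M[G]_n) m (lab : 'I_m -> nat) :
  equivalent w (mxdiag (fun l => irr_mx u (lab l))) ->
  exists S, @decomposition n w m lab S.
Proof.
case=> S [S1 S2 E]; exists (fun l => submxcol S l).
have E' := intertwiner_unitary S1 S2 E.
have scS : sc S = \mxcol_l sc (submxcol S l).
  by rewrite -[LHS]submxcolK; apply: eq_mxcol => l; apply/matrixP => i j; rewrite !mxE.
have scS' : sc (S ^t*) = \mxrow_l sc ((submxcol S l) ^t*).
  by rewrite -[LHS]submxrowK; apply: eq_mxrow => l; apply/matrixP => i j; rewrite !mxE.
split.
- move=> l; move: E; rewrite scS mul_mxdiag_mxcol mxcol_mul.
  by move/(congr1 (fun M => submxcol M l)); rewrite !mxcolK.
- move=> l; move: E'; rewrite /intertwiner scS' mul_mxrow_mxdiag mul_mxrow.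
  by move/(congr1 (fun M => submxrow M l)); rewrite !mxrowK.
- move=> l; apply/matrixP => a b.
  transitivity ((S *m S ^t*) (tagnat.Rank l a) (tagnat.Rank l b)).
    by rewrite !mxE; apply: eq_bigr => k _; rewrite !mxE.
  by rewrite S2 !mxE -val_eqE tagnat.eq_Rank eqxx.
- have S'E : S ^t* = \mxrow_l (submxcol S l) ^t*.
    by rewrite -[LHS]submxrowK; apply: eq_mxrow => l; apply/matrixP => i j; rewrite !mxE.
  by rewrite -S1 S'E -[X in _ = _ *m X](submxcolK S) mul_mxrow_mxcol.
Qed.

Lemma fusion_decomposition i j : exists S,
  decomposition (tensmx (irr_mx u i) (irr_mx u j))
    (m := (minn i j).+1) (lab := fun l => (maxn i j - minn i j + 2 * l)%N) S.
Proof. exact/decomposition_mxdiag/irr_fusion. Qed.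

Lemma fundamental_decomposition k : exists S,
  decomposition (tensmx (fo_gen G) (irr_mx u k))
    (m := (minn 1 k).+1) (lab := fun l => (maxn 1 k - minn 1 k + 2 * l)%N) S.
Proof.
have [S [St Sf Si Ss]] := fusion_decomposition 1 k.
have [T [T1 T2 TE]] := irr_fundamental u.
pose T' := tensmx T (1%:M : 'M[C]_(d k)).
have T'E : intertwiner (tensmx (irr_mx u 1) (irr_mx u k))
    (tensmx (fo_gen G) (irr_mx u k)) T'.
  exact: intertwiner_tens TE (intertwiner1 _).
have [T'1 T'2] : T' ^t* *m T' = 1%:M /\ T' *m T' ^t* = 1%:M.
  rewrite /T' adj_tens !tensmx_mul T1 T2 trmx1 map_mx1 mul1mx tensmx_id.
  by rewrite tensmx_id.
have E l : (S l *m T' ^t*) ^t* = T' *m (S l) ^t*.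
  by rewrite trmx_mul map_mxM trmxCK.
exists (fun l => S l *m T' ^t*); split=> [l|l|l|].
- apply: (intertwiner_comp (St l)); exact: intertwiner_unitary.
- rewrite E; exact: intertwiner_comp T'E (Sf l).
- by rewrite E -mulmxA (mulmxA (T' ^t*)) T'1 mul1mx Si.
- under eq_bigr do rewrite E -mulmxA (mulmxA (_ ^t*)).
  by rewrite -mulmx_sumr -mulmx_suml Ss mul1mx T'2.
Qed.

Lemma equivalent_size m n (v : 'M[G]_m) (w : 'M[G]_n) : equivalent v w -> m = n.
Proof.
by case=> S [S1 S2 _]; apply/anti_leq; rewrite (mulmx1_min S1) (mulmx1_min S2).
Qed.

Lemma irr_dim0 : d 0 = 1%N.
Proof. exact: equivalent_size (irr_trivial u). Qed.

Lemma irr_dim1 : d 1 = N.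
Proof. exact: equivalent_size (irr_fundamental u). Qed.

(** Equivalent representations have equal size; this is the size count of the fusion rule for
    [u^1 (x) u^(k+1)]. *)
Lemma irr_dimS k : (d k.+2 + d k)%N = (N * d k.+1)%N.
Proof.
have := equivalent_size (irr_fusion u 1 k.+1).
rewrite irr_dim1 => ->; have -> : minn 1 k.+1 = 1%N by lia.
rewrite big_ord_recl big_ord1 addnC; congr (d _ + d _)%N ; rewrite ?lift0 /=; lia.
Qed.

End Irreducibles.

(** * Tensor powers of the fundamental representation *)

Section Words.
Variable N : nat.
Implicit Types (x y : seq 'I_N).

Fixpoint words n : seq (seq 'I_N) :=
  if n is n'.+1 then [seq c :: x | c <- enum 'I_N, x <- words n'] else [:: [::]].

Lemma size_words n x : x \in words n -> size x = n.
Proof.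
elim: n x => [|n IH] x /=; first by rewrite inE => /eqP ->.
by case/allpairsP => -[c y] /= [_ /IH <- ->].
Qed.

Section Sums.
Variable V : nmodType.
Implicit Type f : seq 'I_N -> V.

Lemma sum_words0 f : \sum_(x <- words 0) f x = f [::].
Proof. by rewrite big_seq1. Qed.

Lemma sum_wordsS n f :
  \sum_(x <- words n.+1) f x = \sum_c \sum_(x <- words n) f (c :: x).
Proof.
rewrite big_flatten big_map big_enum.
by apply: eq_bigr => c _; rewrite big_map.
Qed.

Lemma eq_sum_words n f f' : (forall x, size x = n -> f x = f' x) ->
  \sum_(x <- words n) f x = \sum_(x <- words n) f' x.
Proof. by move=> E; apply: eq_big_seq => x /size_words /E. Qed.

Lemma sum_words_cat m n f : \sum_(x <- words (m + n)) f x =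
  \sum_(x <- words m) \sum_(y <- words n) f (x ++ y).
Proof.
elim: m f => [|m IH] f; first by rewrite sum_words0.
by rewrite addSn !sum_wordsS; apply: eq_bigr => c _; rewrite IH.
Qed.

Lemma sum_words1 f : \sum_(x <- words 1) f x = \sum_c f [:: c].
Proof. by rewrite sum_wordsS; apply: eq_bigr => c _; rewrite sum_words0. Qed.

End Sums.

Lemma sum_words_delta (K : pzRingType) n (f : seq 'I_N -> K) x : size x = n ->
  \sum_(y <- words n) (x == y)%:R * f y = f x.
Proof.
elim: n f x => [|n IH] f [|a x] //= => [_|[sx]].
  by rewrite big_seq1 eqxx mul1r.
rewrite -/(words n.+1) sum_wordsS (bigD1 a) //= [X in _ + X]big1 => [|c ne].
  rewrite addr0 -(IH (fun y => f (a :: y)) _ sx).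
  by apply: eq_bigr => y _; rewrite eqseq_cons eqxx.
by rewrite big1 // => y _; rewrite eqseq_cons eq_sym (negPf ne) mul0r.
Qed.

Variable c0 : 'I_N.

(** Written recursively so that tensoring with one more factor has the right size by computation. *)
Fixpoint dimn n := if n is n'.+1 then (N * dimn n')%N else 1%N.

(** Meaningful for words of length [n]; [c0] only fills in letters of shorter words. *)
Fixpoint idx n x : 'I_(dimn n) :=
  if n is n'.+1 then mxtens_index (head c0 x, idx n' (behead x)) else ord0.

Lemma sum_idx (V : nmodType) n (f : 'I_(dimn n) -> V) :
  \sum_i f i = \sum_(x <- words n) f (idx n x).
Proof.
elim: n f => [|n IH] f; first by rewrite big_ord1 sum_words0.
rewrite sum_mxtens sum_wordsS; apply: eq_bigr => c _; exact: IH.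
Qed.

Lemma idx_onto n i : exists2 x, size x = n & i = idx n x.
Proof.
elim: n i => [|n IH] i; first by exists [::] => //; rewrite ord1.
case: (mxtens_indexP i) => c j; have [x sx ->] := IH j.
by exists (c :: x) => //=; rewrite sx.
Qed.

End Words.

Section TensorPowers.
Variables (R : realType) (N : nat) (F : 'M[R[i]]_N) (G : freeOrthogonal F).
Variable (u : irreps G) (c0 : 'I_N) (hF : kac_parameter F).
Notation C := R[i].
Notation sc := (@scalar_entries R G _ _).
Notation d := (irr_dim u).
Notation dimn := (dimn N).
Notation idx := (idx c0).
Notation gen := (fo_gen G).

Fixpoint gen_power n : 'M[G]_(dimn n) :=
  if n is n'.+1 then tensmx gen (gen_power n') else 1%:M.

Fixpoint gen_word (x y : seq 'I_N) : G :=
  match x, y with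
  | a :: x', b :: y' => gen a b * gen_word x' y'
  | _, _ => 1
  end.

Lemma gen_power_idx n x y : size x = n -> size y = n ->
  gen_power n (idx n x) (idx n y) = gen_word x y.
Proof.
elim: n x y => [|n IH] [|a x] [|b y] //=; first by rewrite mxE.
by move=> [sx] [sy]; rewrite tensmxE IH.
Qed.

Lemma gen_word_cat x y x' y' : size x = size y ->
  gen_word (x ++ x') (y ++ y') = gen_word x y * gen_word x' y'.
Proof.
elim: x y => [|a x IH] [|b y] //= => [_|[/IH ->]]; first by rewrite mul1r.
by rewrite mulrA.
Qed.

Lemma Fstar : F ^t* *m F = 1%:M /\ F *m F ^t* = 1%:M.
Proof. by case: hF => _ _ FF; split=> //; apply: mulmx1C. Qed.

Lemma invF : invmx F = F ^t*.
Proof.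
by rewrite -[RHS]mulmx1 -(mulmxV (proj1 (mulmx1_unit Fstar.2))) mulmxA Fstar.1 mul1mx.
Qed.

Notation genbar := (map_mx cstar gen).

Lemma gen_bar : gen = sc F *m genbar *m sc (F ^t*).
Proof. by rewrite -invF; case: (fo_relations G). Qed.

Lemma bar_gen : genbar = sc (F ^t*) *m gen *m sc F.
Proof.
rewrite [in RHS]gen_bar !mulmxA -scalar_entriesM Fstar.1 scalar_entries1 mul1mx.
rewrite -mulmxA -scalar_entriesM Fstar.1 scalar_entries1 mulmx1.
by [].
Qed.

Lemma genbar_unitary : genbar^T *m gen = 1%:M /\ gen *m genbar^T = 1%:M.
Proof. by case: (fo_relations G) => -[]. Qed.

(** Here the Kac condition acts: [genbar] is conjugate to [gen] by the unitary [F], hence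
    unitary. *)
Lemma gen_unitary_bar : gen^T *m genbar = 1%:M /\ genbar *m gen^T = 1%:M.
Proof.
have E : gen^T = adjoint_mx genbar.
  by apply/matrixP => i j; rewrite !mxE cstarK.
have E' : adjoint_mx genbar = sc (F ^t*) *m adjoint_mx gen *m sc F.
  by rewrite bar_gen !adjoint_mxM !adjoint_scalar_entries trmxCK mulmxA.
have [g1 g2] := genbar_unitary.
rewrite E E' bar_gen; split; rewrite !mulmxA.
- rewrite -[_ *m sc F *m _]mulmxA -scalar_entriesM Fstar.2 scalar_entries1 mulmx1.
  by rewrite -[_ *m _ *m gen]mulmxA g1 mulmx1 -scalar_entriesM Fstar.1 scalar_entries1.
- rewrite -[_ *m sc F *m _]mulmxA -scalar_entriesM Fstar.2 scalar_entries1 mulmx1.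
  by rewrite -[_ *m gen *m _]mulmxA g2 mulmx1 -scalar_entriesM Fstar.1 scalar_entries1.
Qed.

(** In matrix form [gen F gen^T = F]: the defining relation makes [F], seen as a tensor, an
    invariant vector of [gen (x) gen]. *)
Lemma cup_gen a b : \sum_c \sum_e F c e *: (gen a c * gen b e) = F a b *: 1.
Proof.
have E : gen *m sc F *m gen^T = sc F.
  rewrite {1}gen_bar -[_ *m sc F]mulmxA -scalar_entriesM Fstar.1 scalar_entries1 mulmx1 -mulmxA.
  by rewrite gen_unitary_bar.2 mulmx1.
transitivity ((gen *m sc F *m gen^T) a b); last by rewrite E mxE.
rewrite mxE exchange_big.
apply: eq_bigr => e _; rewrite mulmx_scalar_entriesE mulr_suml; apply: eq_bigr => c _.
by rewrite mxE scalerAl.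
Qed.

Lemma cap_gen c e : \sum_a \sum_b (F a b)^* *: (gen a c * gen b e) = (F c e)^* *: 1.
Proof.
have E : sc (map_mx Num.conj F) *m gen = genbar *m sc (map_mx Num.conj F).
  have : gen *m sc F = sc F *m genbar.
    by rewrite {1}gen_bar -mulmxA -scalar_entriesM Fstar.1 scalar_entries1 mulmx1.
  move=> /matrixP E; apply/matrixP => i j; have := congr1 cstar (E i j).
  rewrite !mul_scalar_entriesE !mulmx_scalar_entriesE !cstar_sum => E'.
  transitivity (\sum_k cstar (F i k *: genbar k j)).
    by apply: eq_bigr => k _; rewrite !mxE cstarZ cstarK.
  by rewrite -E'; apply: eq_bigr => k _; rewrite !mxE cstarZ.
have E' : gen^T *m sc (map_mx Num.conj F) *m gen = sc (map_mx Num.conj F).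
  by rewrite -mulmxA E mulmxA gen_unitary_bar.1 mul1mx.
transitivity ((gen^T *m sc (map_mx Num.conj F) *m gen) c e).
  rewrite mxE exchange_big.
  apply: eq_bigr => b _; rewrite mulmx_scalar_entriesE mulr_suml; apply: eq_bigr => a _.
  by rewrite !mxE scalerAl.
by rewrite E' !mxE.
Qed.

(* Contraction of the first two of three tensor legs with the conjugate of F. *)
Definition capmx n : 'M[C]_(n, N * (N * n)) := \matrix_(i, j)
  (let: (a, j') := mxtens_unindex j in
   let: (b, i') := mxtens_unindex j' in (F a b)^* * (i == i')%:R).

Lemma capmxE n i a b j :
  capmx n i (mxtens_index (a, mxtens_index (b, j))) = (F a b)^* * (i == j)%:R.
Proof. by rewrite mxE !mxtens_indexK. Qed.

Lemma capmx_intertwiner n (w : 'M[G]_n) :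
  intertwiner (tensmx gen (tensmx gen w)) w (capmx n).
Proof.
apply/matrixP => i j; rewrite mul_scalar_entriesE mulmx_scalar_entriesE.
case: (mxtens_indexP j) => c j1; case: (mxtens_indexP j1) => e k {j j1}.
transitivity (\sum_a \sum_b (F a b)^* *: (gen a c * gen b e) * w i k).
  rewrite sum_mxtens; apply: eq_bigr => a _; rewrite sum_mxtens.
  apply: eq_bigr => b _; rewrite (bigD1 i) //= big1 => [|l ne].
    by rewrite capmxE !tensmxE eqxx mulr1 addr0 mulrA scalerAl.
  by rewrite capmxE eq_sym (negPf ne) mulr0 scale0r.
under eq_bigr do rewrite -mulr_suml.
rewrite -mulr_suml cap_gen (bigD1 k) //= big1 => [|l ne].
  by rewrite capmxE eqxx mulr1 addr0 -scalerAl mul1r.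
by rewrite capmxE (negPf ne) mulr0 scale0r.
Qed.

Lemma capmx_tensE n p (T : 'M[C]_(N * n, p)) i c k :
  (capmx n *m tensmx 1%:M T) i (mxtens_index (c, k)) =
  \sum_b (F c b)^* * T (mxtens_index (b, i)) k.
Proof.
rewrite mxE sum_mxtens (bigD1 c) //= [X in _ + X]big1 => [|a ne].
  rewrite addr0 sum_mxtens; apply: eq_bigr => b _.
  rewrite (bigD1 i) //= big1 => [|l ne].
    by rewrite capmxE tensmxE [1%:M _ _]mxE !eqxx mulr1 mul1r addr0.
  by rewrite capmxE eq_sym (negPf ne) mulr0 mul0r.
by rewrite big1 // => j _; rewrite tensmxE [1%:M _ _]mxE (negPf ne) mul0r mulr0.
Qed.

(** Half of Frobenius reciprocity: bending the contracted strand back with the unitary [F] recovers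
    [T]. *)
Lemma capmx_tens_eq0 n p (T : 'M[C]_(N * n, p)) :
  capmx n *m tensmx 1%:M T = 0 -> T = 0.
Proof.
move=> T0; apply/matrixP => a k; case: (mxtens_indexP a) => b' i {a}.
rewrite [RHS]mxE.
transitivity (\sum_c F c b' * (capmx n *m tensmx 1%:M T) i (mxtens_index (c, k))).
  under [RHS]eq_bigr => c _ do rewrite capmx_tensE mulr_sumr.
  have E b : \sum_c F c b' * (F c b)^* = (b == b')%:R.
    have /matrixP/(_ b b') := Fstar.1; rewrite [in RHS]mxE => <-.
    by rewrite mxE; apply: eq_bigr => c _; rewrite !mxE mulrC.
  rewrite exchange_big /= (bigD1 b') //= [X in _ + X]big1 => [|b ne].
    by under eq_bigr do rewrite mulrA; rewrite -mulr_suml E eqxx mul1r addr0.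
  by under eq_bigr do rewrite mulrA; rewrite -mulr_suml E (negPf ne) mul0r.
by rewrite T0 big1 // => c _; rewrite mxE mulr0.
Qed.

(** The labels in the fusion rules equal the expected ones only up to a proof, and matrix sizes
    depend on them; this transports a summand along such an equality. *)
Lemma relabel n (w : 'M[G]_n) a b (S : 'M[C]_(d a, n)) : a = b ->
  exists S' : 'M[C]_(d b, n), S' ^t* *m S' = S ^t* *m S /\
   (S *m S ^t* = 1%:M -> intertwiner w (irr_mx u a) S ->
    intertwiner (irr_mx u a) w (S ^t*) ->
    [/\ S' *m S' ^t* = 1%:M, intertwiner w (irr_mx u b) S'
      & intertwiner (irr_mx u b) w (S' ^t*)]).
Proof. by move=> <-; exists S. Qed.

Lemma fundamental_split k :
  exists (Sp : 'M[C]_(d k.+2, N * d k.+1)) (Sm : 'M[C]_(d k, N * d k.+1)),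
  [/\ Sp *m Sp ^t* = 1%:M,
      intertwiner (tensmx gen (irr_mx u k.+1)) (irr_mx u k.+2) Sp
    & intertwiner (irr_mx u k.+2) (tensmx gen (irr_mx u k.+1)) (Sp ^t*)] /\
  [/\ Sm *m Sm ^t* = 1%:M,
      intertwiner (tensmx gen (irr_mx u k.+1)) (irr_mx u k) Sm,
      intertwiner (irr_mx u k) (tensmx gen (irr_mx u k.+1)) (Sm ^t*)
    & Sp ^t* *m Sp + Sm ^t* *m Sm = 1%:M].
Proof.
have := fundamental_decomposition u k.+1.
have -> : minn 1 k.+1 = 1%N by lia.
have -> : maxn 1 k.+1 = k.+1 by lia.
case=> S [St Sf Si]; rewrite big_ord_recl big_ord1 => Ss.
have [Sm [Em SmP]] := relabel (tensmx gen (irr_mx u k.+1)) (S ord0)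
  (ltac:(by rewrite /=; lia) : (k.+1 - 1 + 2 * (ord0 : 'I_2))%N = k).
have [Sp [Ep SpP]] := relabel (tensmx gen (irr_mx u k.+1)) (S (lift ord0 ord0))
  (ltac:(by rewrite lift0 /=; lia) :
    (k.+1 - 1 + 2 * (lift ord0 ord0 : 'I_2))%N = k.+2).
exists Sp, Sm; split; first exact: SpP.
have [? ? ?] := SmP (Si _) (St _) (Sf _); split=> //.
by rewrite Em Ep addrC.
Qed.

(** Capping off one factor turns [T] into a map from [u^1 (x) u^k] to a shorter power, thus into
    maps from [u^(k+1)] and [u^(k-1)], which vanish by induction; by [capmx_tens_eq0] nothing was
    lost. *)
Lemma no_intertwiner n k (T : 'M[C]_(dimn n, d k)) : (n < k)%N ->
  intertwiner (irr_mx u k) (gen_power n) T -> T = 0.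
Proof.
elim: n k T => [|n IH] [//|k] T nk TE.
  have [S [S1 S2 SE]] := irr_trivial u.
  have := schur_neq (intertwiner_comp (intertwiner_unitary S1 S2 SE) TE).
  by move/(_ isT) => E; rewrite -[T]mul1mx -S2 -mulmxA E mulmx0.
have [Sp [Sm [[_ _ Spf] [_ _ Smf Ss]]]] := fundamental_split k.
apply: capmx_tens_eq0; set T' := _ *m _.
have T'E : intertwiner (tensmx gen (irr_mx u k.+1)) (gen_power n) T'.
  apply: intertwiner_comp (capmx_intertwiner (gen_power n)) _.
  exact: intertwiner_tens (intertwiner1 _) TE.
rewrite -[T']mulmx1 -Ss mulmxDr !mulmxA.
rewrite (IH k.+2 _ _ (intertwiner_comp T'E Spf)) 1?(ltnW, ltnW nk) //; last first.
  by rewrite (leq_trans nk).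
by rewrite (IH k _ nk (intertwiner_comp T'E Smf)) !mul0mx addr0.
Qed.

(** The cap at position [i] of [n.+2] strands. Out of range it is zero, which is still an
    intertwiner. *)
Fixpoint capat i n : 'M[C]_(dimn n, dimn n.+2) :=
  if i is i'.+1 then
    if n is n'.+1 then tensmx (1%:M : 'M[C]_N) (capat i' n') else 0
  else capmx (dimn n).

Lemma capat_intertwiner i n : intertwiner (gen_power n.+2) (gen_power n) (capat i n).
Proof.
elim: i n => [|i IH] n; first exact: capmx_intertwiner.
case: n => [|n].
  by rewrite /intertwiner /scalar_entries /= map_mx0 mul0mx mulmx0.
exact: intertwiner_tens (intertwiner1 _) (IH n).
Qed.

Lemma capatE x y n p (W : 'M[C]_(dimn n.+2, p)) k : (size x + size y)%N = n ->
  (capat (size x) n *m W) (idx n (x ++ y)) k =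
  \sum_a \sum_b (F a b)^* * W (idx n.+2 (x ++ a :: b :: y)) k.
Proof.
elim: x n W => [|c x IH] n W /=.
  move=> sy; rewrite mxE sum_mxtens; apply: eq_bigr => a _.
  rewrite sum_mxtens; apply: eq_bigr => b _; rewrite (bigD1 (idx n y)) //=.
  rewrite big1 => [|l ne]; first by rewrite capmxE eqxx mulr1 addr0.
  by rewrite capmxE eq_sym (negPf ne) mulr0 mul0r.
case: n W => // n W [sxy] /=.
pose W' : 'M[C]_(dimn n.+2, p) := \matrix_(i, j) W (mxtens_index (c, i)) j.
transitivity ((capat (size x) n *m W') (idx n (x ++ y)) k).
  rewrite !mxE sum_mxtens (bigD1 c) //= [X in _ + X]big1 => [|e ne].
    by rewrite addr0; apply: eq_bigr => j _; rewrite tensmxE !mxE eqxx mul1r.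
  by rewrite big1 // => j _; rewrite tensmxE [1%:M _ _]mxE eq_sym (negPf ne) !mul0r.
rewrite IH //; apply: eq_bigr => a _; apply: eq_bigr => b _.
by rewrite mxE.
Qed.

Definition killed k (f : seq 'I_N -> C) :=
  forall x y, (size x + size y).+2 = k ->
  \sum_a \sum_b (F a b)^* * f (x ++ a :: b :: y) = 0.

(** [emb_range] says that [W W'] fixes every killed tensor; the converse inclusion is
    [emb_killed]. *)
Record embedding k (W : 'M[C]_(dimn k, d k)) := Embedding {
  emb_to : intertwiner (irr_mx u k) (gen_power k) W;
  emb_from : intertwiner (gen_power k) (irr_mx u k) (W ^t*);
  emb_iso : W ^t* *m W = 1%:M;
  emb_range : forall f, killed k f -> forall x, size x = k ->
    f x = \sum_al W (idx k x) al *
            \sum_(y <- words N k) (W (idx k y) al)^* * f y }.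

(** A cap composed with [W] maps an irreducible to a tensor power two shorter, so [no_intertwiner]
    applies. *)
Lemma emb_killed k W al : embedding W -> killed k (fun x => W (idx k x) al).
Proof.
case: k W al => [|[|k]] W al We x y // [sxy].
rewrite -capatE // (_ : _ *m _ = 0) ?mxE //.
apply: (@no_intertwiner k k.+2) => //.
by apply: intertwiner_comp (emb_to We); apply: capat_intertwiner.
Qed.

Lemma embedding0 : exists W, @embedding 0 W.
Proof.
have [S [S1 S2 SE]] := irr_trivial u.
exists S; split=> //; first exact: intertwiner_unitary.
move=> f _ [|//] _.
transitivity ((S *m S ^t*) (idx 0 [::]) (idx 0 [::]) * f [::]).
  by rewrite S2 mxE eqxx mul1r.
rewrite mxE mulr_suml; apply: eq_bigr => al _.
by rewrite sum_words0 !mxE mulrA.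
Qed.

Lemma embedding1 : exists W, @embedding 1 W.
Proof.
have [S [S1 S2 SE]] := irr_fundamental u.
pose e (i : 'I_(dimn 1)) : 'I_N := (mxtens_unindex i).1.
have eE a : e (idx 1 [:: a]) = a := congr1 fst (mxtens_indexK (a, ord0)).
pose W : 'M[C]_(dimn 1, d 1) := \matrix_(i, j) S (e i) j.
have UE i j : gen_power 1 i j = gen (e i) (e j).
  have [[|a []] // _ ->] := idx_onto c0 i; have [[|b []] // _ ->] := idx_onto c0 j.
  by rewrite gen_power_idx // !eE /= mulr1.
have sumE (V : nmodType) (f : 'I_N -> V) : \sum_(i < dimn 1) f (e i) = \sum_a f a.
  by rewrite (sum_idx c0) sum_words1; apply: eq_bigr => a _; rewrite eE.
exists W; split.
- apply/matrixP => i j; have /matrixP/(_ (e i) j) := SE.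
  rewrite !mul_scalar_entriesE !mulmx_scalar_entriesE => E.
  transitivity (\sum_k S (e i) k *: irr_mx u 1 k j).
    by apply: eq_bigr => k _; rewrite mxE.
  rewrite E -sumE; apply: eq_bigr => k _; by rewrite UE mxE.
- apply/matrixP => j i; have /matrixP/(_ j (e i)) := intertwiner_unitary S1 S2 SE.
  rewrite !mul_scalar_entriesE !mulmx_scalar_entriesE -sumE => E.
  transitivity (\sum_(k < dimn 1) (S ^t*) j (e k) *: gen (e k) (e i)).
    by apply: eq_bigr => k _; rewrite UE !mxE.
  by rewrite E; apply: eq_bigr => k _; rewrite !mxE.
- apply/matrixP => i j; rewrite -S1 !mxE -sumE.
  by apply: eq_bigr => k _; rewrite !mxE.
- move=> f _ [|a []] // _.
  transitivity (\sum_b (S *m S ^t*) a b * f [:: b]).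
    rewrite S2 (bigD1 a) //= big1 => [|b ne]; first by rewrite mxE eqxx mul1r addr0.
    by rewrite mxE eq_sym (negPf ne) mul0r.
  rewrite (eq_bigr _ (fun al _ => congr1 _ (sum_words1 _))).
  under [RHS]eq_bigr do rewrite mulr_sumr; rewrite exchange_big.
  apply: eq_bigr => b _; rewrite mxE mulr_suml; apply: eq_bigr => al _.
  by rewrite [W _ _]mxE [W _ _]mxE !eE !mxE mulrA.
Qed.

(** The new isometry is [(1 (x) W1) Sp']. A killed tensor lies in the range of [1 (x) W1], since its
    slices by the first letter are killed; its first cap also vanishes, which has to exclude the
    component in [u^k]. *)
Lemma embeddingSS k : (exists W, @embedding k W) -> (exists W, @embedding k.+1 W) ->
  exists W, @embedding k.+2 W.
Proof.
move=> [W0 W0e] [W1 W1e].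
have [Sp [Sm [[Spi Spt Spf] [Smi Smt Smf Ss]]]] := fundamental_split k.
pose J := tensmx (1%:M : 'M[C]_N) W1.
have Jt : intertwiner (tensmx gen (irr_mx u k.+1)) (gen_power k.+2) J.
  exact: intertwiner_tens (intertwiner1 _) (emb_to W1e).
have Jstar : J ^t* = tensmx (1%:M : 'M[C]_N) (W1 ^t*).
  by rewrite adj_tens trmx1 map_mx1.
have Jf : intertwiner (gen_power k.+2) (tensmx gen (irr_mx u k.+1)) (J ^t*).
  by rewrite Jstar; exact: intertwiner_tens (intertwiner1 _) (emb_from W1e).
have JJ : J ^t* *m J = 1%:M.
  by rewrite Jstar tensmx_mul mul1mx (emb_iso W1e) tensmx_id.
have WE : (J *m Sp ^t*) ^t* = Sp *m J ^t* by rewrite trmx_mul map_mxM trmxCK.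
exists (J *m Sp ^t*); split.
- exact: intertwiner_comp Jt Spf.
- rewrite WE; exact: intertwiner_comp Spt Jf.
- by rewrite WE -mulmxA (mulmxA (J ^t*)) JJ mul1mx.
move=> f fk [|c x] // [sx].
(* The coordinates of [f] with respect to [1 (x) W1]. *)
pose g : 'cV[C]_(N * d k.+1) := \col_a
  \sum_(y <- words N k.+1) (W1 (idx k.+1 y) (mxtens_unindex a).2)^* *
     f ((mxtens_unindex a).1 :: y).
have gE c' be : g (mxtens_index (c', be)) 0 =
    \sum_(y <- words N k.+1) (W1 (idx k.+1 y) be)^* * f (c' :: y).
  by rewrite mxE mxtens_indexK.
have fE c' y : size y = k.+1 ->
    f (c' :: y) = \sum_be W1 (idx k.+1 y) be * g (mxtens_index (c', be)) 0.
  move=> sy; rewrite (emb_range W1e (f := fun y => f (c' :: y))) //.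
    by apply: eq_bigr => be _; rewrite gE.
  by move=> x1 y1 sxy; rewrite (fk (c' :: x1)) //= addSn sxy.
(* Composing with [W0'] makes the first cap an intertwiner onto [u^k], hence a multiple of [Sm]. *)
pose Y := W0 ^t* *m (capmx (dimn k) *m J).
have Yt : intertwiner (tensmx gen (irr_mx u k.+1)) (irr_mx u k) Y.
  apply: intertwiner_comp (emb_from W0e) _.
  exact: intertwiner_comp (capmx_intertwiner _) Jt.
have Yg : Y *m g = 0.
  rewrite /Y -!mulmxA; set z := capmx _ *m _; suff -> : z = 0 by rewrite mulmx0.
  apply/matrixP => i j; rewrite ord1 [RHS]mxE {j}.
  have [y sy ->] := idx_onto c0 i.
  rewrite /z mulmxA mxE sum_mxtens.
  rewrite -[RHS](fk [::] y) ?sy //; apply: eq_bigr => a _.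
  under eq_bigr do rewrite capmx_tensE mulr_suml.
  rewrite exchange_big; apply: eq_bigr => b _.
  rewrite /= fE /= ?sy // mulr_sumr; apply: eq_bigr => be _.
  by rewrite mulrA.
have [t Yy] : exists t, Y = t *: Sm.
  have [t tE] := schur (irr_irreducible u k) (intertwiner_comp Yt Smf).
  have Y0 : Y *m Sp ^t* = 0.
    by apply: (schur_neq (intertwiner_comp Yt Spf)); lia.
  exists t; rewrite -[Y]mulmx1 -Ss mulmxDr !mulmxA Y0 tE mul0mx add0r.
  by rewrite mul_scalar_mx.
(* If [Y = 0], the slices of [W1] by the first letter, being killed tensors in the range of [W0],
   have zero coordinates there; then [W1 = 0], against isometry. *)
have t0 : t != 0.
  apply/eqP => t0; move: Yy; rewrite t0 scale0r => Y0.
  suff W10 : W1 = 0.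
    have := emb_iso W1e; rewrite W10 mulmx0 => /matrixP.
    move/(_ (Ordinal (irr_dim_gt0 u _)) (Ordinal (irr_dim_gt0 u _))).
    by rewrite !mxE eqxx => /esym/eqP; rewrite oner_eq0.
  apply/matrixP => i be; rewrite mxE; have [[|b x1] // [sx1] ->] := idx_onto c0 i.
  have W1k := emb_killed be W1e.
  rewrite (emb_range W0e (f := fun x => W1 (idx k.+1 (b :: x)) be)) //; last first.
    by move=> x2 y2 sxy; rewrite (W1k (b :: x2)) //= addSn sxy.
  apply: big1 => al _; set z := \sum_(_ <- _) _; suff -> : z = 0 by rewrite mulr0.
  (* These coordinates form a vector in the free letter; the trivial factor [1] lets
     [capmx_tens_eq0] apply. *)
  pose T : 'M[C]_(N * 1, 1) := \matrix_(b, j)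
    \sum_(x <- words N k) (W0 (idx k x) al)^* *
       W1 (idx k.+1 ((mxtens_unindex b).1 :: x)) be.
  have T0 : T = 0.
    apply: capmx_tens_eq0; apply/matrixP => i' j'.
    case: (mxtens_indexP j') => e j1; rewrite capmx_tensE [RHS]mxE.
    transitivity (Y al (mxtens_index (e, be))); last by rewrite Y0 mxE.
    rewrite /Y [in RHS]mxE (sum_idx c0).
    under [LHS]eq_bigr do rewrite [T _ _]mxE mxtens_indexK mulr_sumr.
    rewrite exchange_big /=; apply: eq_bigr => x2 _.
    rewrite capmx_tensE mulr_sumr; apply: eq_bigr => b2 _.
    by rewrite !mxE mulrCA.
  have /matrixP/(_ (mxtens_index (b, ord0)) ord0) := T0.
  by rewrite [in LHS]mxE [in RHS]mxE mxtens_indexK.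
have gp : g = Sp ^t* *m (Sp *m g).
  have : Sm *m g = 0.
    by apply: (scalerI t0); rewrite scalemxAl -Yy Yg scaler0.
  move=> Sg; rewrite -[LHS]mul1mx -Ss mulmxDl -!mulmxA Sg mulmx0 addr0.
  by [].
have WpE c' y al : size y = k.+1 -> (J *m Sp ^t*) (idx k.+2 (c' :: y)) al =
    \sum_be W1 (idx k.+1 y) be * (Sp ^t*) (mxtens_index (c', be)) al.
  move=> sy; rewrite mxE sum_mxtens (bigD1 c') //= [X in _ + X]big1 => [|e ne].
    by rewrite addr0; apply: eq_bigr => be _; rewrite tensmxE [1%:M _ _]mxE eqxx mul1r.
  by rewrite big1 // => be _; rewrite tensmxE [1%:M _ _]mxE eq_sym (negPf ne) !mul0r.
have SgE al : (Sp *m g) al 0 =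
    \sum_(y <- words N k.+2) ((J *m Sp ^t*) (idx k.+2 y) al)^* * f y.
  rewrite mxE sum_mxtens sum_wordsS; apply: eq_bigr => c' _.
  under eq_bigr do rewrite gE mulr_sumr.
  rewrite exchange_big; apply: eq_sum_words => y1 sy1.
  rewrite WpE // rmorph_sum mulr_suml; apply: eq_bigr => be _.
  by rewrite rmorphM !mxE /= conjCK mulrA [Sp _ _ * _]mulrC.
rewrite fE // gp.
under eq_bigr do rewrite mxE mulr_sumr.
rewrite exchange_big /=; apply: eq_bigr => al _.
by rewrite SgE WpE // mulr_suml; apply: eq_bigr => be _; rewrite mulrA.
Qed.

Lemma embedding_exists k : exists W, @embedding k W.
Proof.
suff [] : (exists W, @embedding k W) /\ exists W, @embedding k.+1 W by [].
elim: k => [|k [IH IH1]]; first by split; [exact: embedding0 | exact: embedding1].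
by split=> //; exact: embeddingSS.
Qed.

End TensorPowers.

(** * Three-vertices *)

Section Segments.
Variables (N : nat) (c0 : 'I_N).
Implicit Types (w : nat -> 'I_N) (x y : seq 'I_N).

(** With [seg] and [str], the passage between the finite words indexing matrices and the infinite
    words on which cups and caps act. *)
Definition rep a y w : nat -> 'I_N := fun n =>
  if (a <= n < a + size y)%N then nth c0 y (n - a) else w n.
Definition seg a k w : seq 'I_N := [seq w i | i <- iota a k].
Definition str y := rep 0 y (fun=> c0).

Lemma size_seg a k w : size (seg a k w) = k.
Proof. by rewrite size_map size_iota. Qed.

Lemma nth_seg a k w n : (n < k)%N -> nth c0 (seg a k w) n = w (a + n)%N.
Proof. by move=> nk; rewrite (nth_map 0%N) ?size_iota // nth_iota. Qed.

Lemma rep_seg a k w : rep a (seg a k w) w = w.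
Proof.
apply/funext => n; rewrite /rep size_seg; case: ifP => // /andP[an nk].
by rewrite nth_seg ?subnKC //; lia.
Qed.

Lemma seg_rep a k y w : size y = k -> seg a k (rep a y w) = y.
Proof.
move=> sy; apply: (@eq_from_nth _ c0); rewrite size_seg // => n nk.
by rewrite nth_seg // /rep ifT ?addKn //; lia.
Qed.

Lemma rep_rep a x y w : size x = size y -> rep a y (rep a x w) = rep a y w.
Proof. by move=> E; apply/funext => n; rewrite /rep E; case: ifP => // ->. Qed.

Lemma rep_cat a x y w : rep a (x ++ y) w = rep (a + size x) y (rep a x w).
Proof.
apply/funext => n; rewrite /rep size_cat nth_cat.
do ?[case: ifPn => ?]; try lia; try reflexivity; congr (nth _ _ _); lia.
Qed.

Lemma rep_pair a x c e y w : rep a (x ++ c :: e :: y) w =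
  ins2 (a + size x) c e (rep a (x ++ y) (del2 (a + size x + size y) w)).
Proof.
apply/funext => n; rewrite /rep /ins2 /del2 !size_cat !nth_cat /=.
have [nx|xn] := ltnP n (a + size x).
  do ?[case: ifPn => ?]; try lia; reflexivity.
have [->|n1] := eqVneq n (a + size x)%N.
  rewrite ifT; last by lia.
  by rewrite ifN ?addKn ?subnn //; lia.
have [->|n2] := eqVneq n (a + size x).+1.
  rewrite ifT; last by lia.
  rewrite ifN; last by lia.
  by rewrite (_ : ((a + size x).+1 - a - size x = 1)%N) //; lia.
have [m nE] : exists m, n = (m + a + size x).+2 by exists (n - (a + size x).+2)%N; lia.
rewrite nE /=.
have -> : ((m + a + size x).+2 - a - size x = m.+2)%N by lia.
have -> : ((m + a + size x) - a - size x = m)%N by lia.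
do ?[case: ifPn => ?]; try lia; reflexivity.
Qed.

Lemma str_pair x c e y : str (x ++ c :: e :: y) = ins2 (size x) c e (str (x ++ y)).
Proof.
rewrite /str rep_pair add0n; congr ins2; congr rep.
by apply/funext => n; rewrite /del2; case: ifP.
Qed.

Lemma str_cat x y : str (x ++ y) = rep (size x) y (str x).
Proof. by rewrite /str rep_cat. Qed.

Lemma seg_cat a m n w : seg a (m + n) w = seg a m w ++ seg (a + m) n w.
Proof. by rewrite /seg iotaD map_cat. Qed.

Lemma seg_str m n x y : size x = m -> size y = n ->
  (seg 0 m (str (x ++ y)) = x) * (seg m n (str (x ++ y)) = y).
Proof.
move=> <- <-; have := seg_cat 0 (size x) (size y) (str (x ++ y)).
rewrite seg_rep ?size_cat // => /eqP; rewrite eqseq_cat ?size_seg //.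
by case/andP=> /eqP <- /eqP <-.
Qed.

Lemma rep_str_l x x' y : size x = size x' -> rep 0 x' (str (x ++ y)) = str (x' ++ y).
Proof.
move=> E; apply/funext => n; rewrite /str /rep !size_cat !nth_cat E.
by do ?[case: ifPn => ?]; try lia.
Qed.

Lemma rep_str_r m x y y' : size x = m -> size y = size y' ->
  rep m y' (str (x ++ y)) = str (x ++ y').
Proof. by move=> <- E; rewrite !str_cat rep_rep. Qed.

End Segments.

Lemma sum_words_addn (V : nmodType) N m n k (f : seq 'I_N -> V) : (m + n)%N = k ->
  \sum_(x <- words N k) f x =
  \sum_(x <- words N m) \sum_(y <- words N n) f (x ++ y).
Proof. by move=> <-; exact: sum_words_cat. Qed.

Lemma sum_words_pair (V : nmodType) N m n k (f : seq 'I_N -> V) :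
  (m + n).+2 = k ->
  \sum_(x <- words N k) f x =
  \sum_(x <- words N m) \sum_(y <- words N n) \sum_c \sum_e f (x ++ c :: e :: y).
Proof.
move=> E; rewrite (@sum_words_addn _ _ m n.+2) ?addnS //.
apply: eq_bigr => x _; rewrite sum_wordsS; under eq_bigr do rewrite sum_wordsS.
under eq_bigr do rewrite exchange_big.
by rewrite exchange_big.
Qed.

(** * Jones-Wenzl projections as projections onto irreducibles *)

Section Projections.
Variables (R : realType) (N : nat) (F : 'M[R[i]]_N) (G : freeOrthogonal F).
Variable (u : irreps G) (c0 : 'I_N) (hF : kac_parameter F).
Notation C := R[i].
Notation d := (irr_dim u).
Notation idx := (idx c0).
Notation rep := (rep c0).
Notation str := (str c0).
Notation V := ((nat -> 'I_N) -> C^o).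

(* The quantum integer [m] is the dimension of u^(m-1). *)
Definition qdim m : C := if m is m'.+1 then (d m')%:R else 0.

Definition scupF i : {linear V -> V} := scup F i.
(** Conjugating [F] makes the cap adjoint to the cup; the loop value is then the trace of [F' F],
    which is [N], and the zigzag sign comes from [F *m conj F]. *)
Definition scapF i : {linear V -> V} := scap (map_mx Num.conj F) i.
Notation sjw := (jw scupF scapF qdim).
Notation scups := (cups scupF).
Notation scaps := (caps scapF).

Lemma qdim0 : qdim 0 = 0. Proof. by []. Qed.

Lemma qdim1 : qdim 1 = 1. Proof. by rewrite /= irr_dim0. Qed.

Lemma qdimSS m : qdim m.+2 = N%:R * qdim m.+1 - qdim m.
Proof.
case: m => [|m]; first by rewrite /= irr_dim0 irr_dim1 subr0 mulr1.
by rewrite /= -natrM -irr_dimS natrD addrK.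
Qed.

Lemma qdim_neq0 m : qdim m.+1 != 0.
Proof. by rewrite /= pnatr_eq0 -lt0n irr_dim_gt0. Qed.

Lemma kac_sign : exists2 eps : C, eps * eps = 1 & F *m map_mx Num.conj F = eps%:M.
Proof.
case: hF => _ [eps e FF] _; exists eps => //.
by case: e => ->; rewrite ?mulr1 ?mulrNN ?mulr1.
Qed.

Lemma trace_FF : \sum_a \sum_b (map_mx Num.conj F) a b * F a b = N%:R :> C.
Proof.
have := congr1 mxtrace (Fstar hF).1; rewrite mxtrace1 => <-.
rewrite exchange_big; apply: eq_bigr => b _; rewrite mxE.
by apply: eq_bigr => a _; rewrite !mxE.
Qed.

Lemma cap_sjw a m i f : (a <= i)%N -> (i.+1 < a + m)%N -> scapF i (sjw a m f) = 0.
Proof.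
have [eps e2 FF] := kac_sign.
apply: (@cap_jw _ _ _ _ N%:R eps) => //.
- exact: scap_scup trace_FF.
- exact: scap_scupS.
- exact: scapS_scup.
- exact: scup_scup.
- exact: scap_scup_left.
- exact: scap_scup_right.
- exact: scap_scap.
- exact: qdim1.
- exact: qdimSS.
- exact: qdim_neq0.
Qed.

Lemma scaps_vertex r s t f :
  scaps s t (vertex scupF scapF qdim r s t f) =
  (\prod_(l < t) vertex_ratio qdim r s l) *: sjw 0 (r + s) f.
Proof.
have [eps e2 FF] := kac_sign.
apply: (@caps_vertex _ _ _ _ N%:R eps) => //.
- exact: scap_scup trace_FF.
- exact: scap_scupS.
- exact: scapS_scup.
- exact: scup_scup.
- exact: scap_scup_left.
- exact: scap_scup_right.
- exact: scap_scap.
- exact: qdim1.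
- exact: qdimSS.
- exact: qdim_neq0.
Qed.

Section Range.
Variables (k : nat) (W : 'M[C]_(dimn N k, d k)).
Hypothesis We : embedding c0 W.

Definition wproj a (f : V) : V := fun w =>
  \sum_al W (idx k (seg a k w)) al *
    \sum_(y <- words N k) (W (idx k y) al)^* * f (rep a y w).

Lemma wproj_linear a : linear (wproj a).
Proof.
move=> b f g; apply/funext => w; rewrite /wproj !fctE scaler_sumr -big_split.
apply: eq_bigr => al _ /=; rewrite /GRing.scale /= mulrCA -mulrDr; congr (_ * _).
rewrite mulr_sumr -big_split; apply: eq_bigr => y _ /=.
by rewrite mulrDr mulrCA.
Qed.
HB.instance Definition _ a := GRing.isLinear.Build C V V *:%R (wproj a) (wproj_linear a).

Lemma wproj_scup a i f : (a <= i)%N -> (i.+1 < a + k)%N -> wproj a (scupF i f) = 0.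
Proof.
move=> ai ik; apply/funext => w; rewrite /wproj big1 // => al _.
set z := \sum_(_ <- _) _; suff -> : z = 0 by rewrite mulr0.
have [p pE] : exists p, i = (a + p)%N by exists (i - a)%N; lia.
have [r rE] : exists r, (p + r).+2 = k by exists (k - p.+2)%N; lia.
rewrite /z (sum_words_pair _ rE) big_seq big1 // => x /size_words sx.
rewrite big_seq big1 // => y /size_words sy.
transitivity (\sum_c \sum_e (W (idx k (x ++ c :: e :: y)) al)^* * F c e *
   f (rep a (x ++ y) (del2 (a + size x + size y) w))).
  apply: eq_bigr => c _; apply: eq_bigr => e _.
  by rewrite /scupF /= /scup rep_pair sx -pE !ins2_at del_ins mulrA.
under eq_bigr do rewrite -mulr_suml.
rewrite -mulr_suml.
have := emb_killed hF al We (x := x) (y := y).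
rewrite sx sy => /(_ rE)/(congr1 Num.conj); rewrite rmorph0 rmorph_sum => E.
set z' := (X in X * _); suff -> : z' = 0 by rewrite mul0r.
transitivity (\sum_c (\sum_e (F c e)^* * W (idx k (x ++ c :: e :: y)) al)^*);
  last exact: E.
apply: eq_bigr => c _; rewrite rmorph_sum; apply: eq_bigr => e _.
by rewrite rmorphM /= conjCK mulrC.
Qed.

Lemma wproj_range a (f : V) :
  (forall i, (a <= i)%N -> (i.+1 < a + k)%N -> scapF i f = 0) -> wproj a f = f.
Proof.
move=> f0; apply/funext => w; rewrite /wproj.
rewrite -[in RHS](rep_seg c0 a k w).
rewrite (emb_range We (f := fun y => f (rep a y w)) _ (size_seg a k w)) //.
move=> x y sxy.
have := f0 (a + size x)%N; rewrite leq_addr => /(_ isT).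
have -> : ((a + size x).+1 < a + k)%N by lia.
move/(_ isT)/(congr1 (fun g => g (rep a (x ++ y) (del2 (a + size x + size y) w)))).
rewrite /scapF /= /scap => E; apply: etrans E.
by do 2![apply: eq_bigr => ? _]; rewrite mxE rep_pair.
Qed.

(** [wproj] fixes the range of [sjw], which the caps kill, and absorbs [sjw], because it kills
    cups. *)
Lemma sjw_wproj a f : sjw a k f = wproj a f.
Proof.
rewrite -[LHS](wproj_range (a := a)); last by move=> *; exact: cap_sjw.
apply: jw_absorb; first exact: qdim0.
exact: wproj_scup.
Qed.

Lemma wproj_emb ga :
  let f := (fun w => W (idx k (seg 0 k w)) ga) : V in wproj 0 f = f.
Proof.
apply/funext => w; rewrite /wproj (bigD1 ga) //= [X in _ + X]big1 => [|al ne].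
  rewrite addr0 -[RHS]mulr1; congr (_ * _).
  transitivity ((W ^t* *m W) ga ga); last by rewrite (emb_iso We) mxE eqxx.
  rewrite mxE (sum_idx c0); apply: eq_sum_words => y sy.
  by rewrite seg_rep // !mxE.
set z := \sum_(_ <- _) _; suff -> : z = 0 by rewrite mulr0.
transitivity ((W ^t* *m W) al ga); last by rewrite (emb_iso We) mxE (negPf ne).
rewrite mxE (sum_idx c0); apply: eq_sum_words => y sy.
by rewrite seg_rep // !mxE.
Qed.

End Range.

Lemma scup_adj n i (f g : V) : (i <= n)%N ->
  \sum_(v <- words N n.+2) (scupF i f (str v))^* * g (str v) =
  \sum_(v <- words N n) (f (str v))^* * scapF i g (str v).
Proof.
move=> i_n; have E : ((i + (n - i)).+2 = n.+2)%N by lia.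
rewrite (sum_words_pair _ E) (@sum_words_addn _ _ i (n - i) n); last by lia.
apply: eq_sum_words => x sx; apply: eq_sum_words => y sy.
rewrite /scupF /scapF /= /scup /scap mulr_sumr; apply: eq_bigr => c _.
rewrite mulr_sumr; apply: eq_bigr => e _.
by rewrite str_pair sx !ins2_at del_ins rmorphM mxE mulrAC mulrC mulrCA mulrA.
Qed.

Lemma scups_adj n s t (f g : V) : (s <= n)%N ->
  \sum_(v <- words N (n + t.*2)) (scups s t f (str v))^* * g (str v) =
  \sum_(v <- words N n) (f (str v))^* * scaps s t g (str v).
Proof.
move=> sn; elim: t g => [|t IH] g; first by rewrite addn0.
rewrite doubleS !addnS scup_adj; last by rewrite -addnn; lia.
by rewrite IH.
Qed.

Section Vertex.
Variables (r s t : nat).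
Local Notation i := (s + t)%N.
Local Notation j := (r + t)%N.
Local Notation k := (r + s)%N.
Variables (Wi : 'M[C]_(dimn N i, d i)) (Wj : 'M[C]_(dimn N j, d j)).
Variables (Wk : 'M[C]_(dimn N k, d k)).
Hypotheses (Wie : embedding c0 Wi) (Wje : embedding c0 Wj).
Hypothesis (Wke : embedding c0 Wk).

Definition kfun ga : V := fun w => Wk (idx k (seg 0 k w)) ga.

Definition threevertex : 'M[C]_(d i * d j, d k) := \matrix_(ab, ga)
  \sum_(p <- words N i) \sum_(q <- words N j)
    (Wi (idx i p) (mxtens_unindex ab).1)^* *
    ((Wj (idx j q) (mxtens_unindex ab).2)^* * scups s t (kfun ga) (str (p ++ q))).

Lemma threevertexE al be ga : threevertex (mxtens_index (al, be)) ga =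
  \sum_(p <- words N i) \sum_(q <- words N j)
    (Wi (idx i p) al)^* * ((Wj (idx j q) be)^* * scups s t (kfun ga) (str (p ++ q))).
Proof. by rewrite mxE mxtens_indexK. Qed.

(** The outer projections of the diagram are [Wi Wi'] and [Wj Wj'], so the diagram is [(Wi (x) Wj)]
    applied to a column of [threevertex]. *)
Lemma vertex_kfun ga p q : size p = i -> size q = j ->
  vertex scupF scapF qdim r s t (kfun ga) (str (p ++ q)) =
  \sum_al \sum_be Wi (idx i p) al * Wj (idx j q) be *
    threevertex (mxtens_index (al, be)) ga.
Proof.
move=> sp sq; rewrite /vertex (sjw_wproj Wke) wproj_emb //.
rewrite (sjw_wproj Wie) (sjw_wproj Wje) {1}/wproj (seg_str _ sp sq).1.
apply: eq_bigr => al _.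
transitivity (Wi (idx i p) al * \sum_(p' <- words N i) (Wi (idx i p') al)^* *
   \sum_be Wj (idx j q) be * \sum_(q' <- words N j) (Wj (idx j q') be)^* *
     scups s t (kfun ga) (str (p' ++ q'))).
  congr (_ * _); apply: eq_sum_words => p' sp'; congr (_ * _).
  rewrite rep_str_l ?sp // /wproj (seg_str _ sp' sq).2.
  apply: eq_bigr => be _; congr (_ * _); apply: eq_sum_words => q' sq'.
  by rewrite (rep_str_r _ sp') ?sq.
under eq_bigr => p' _ do rewrite mulr_sumr.
rewrite exchange_big mulr_sumr; apply: eq_bigr => be _.
rewrite -mulrA; congr (_ * _); rewrite threevertexE mulr_sumr.
apply: eq_bigr => p' _; rewrite mulrCA; congr (_ * _); rewrite mulr_sumr.
by apply: eq_bigr => q' _; rewrite mulrCA.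
Qed.

(** By [vertex_kfun], [X' X] pairs the bare cups with the full vertex. Moving the cups across as
    caps, [scaps_vertex] evaluates the network and the isometry [Wk] removes the rest. *)
Lemma threevertex_gram :
  threevertex ^t* *m threevertex = (\prod_(l < t) vertex_ratio qdim r s l)%:M.
Proof.
apply/matrixP => ga de; rewrite mxE sum_mxtens.
pose v ga := scups s t (kfun ga).
transitivity (\sum_(p <- words N i) \sum_(q <- words N j)
   (v ga (str (p ++ q)))^* * vertex scupF scapF qdim r s t (kfun de) (str (p ++ q))).
  under [RHS]eq_big_seq => p /size_words sp.
    under eq_big_seq => q /size_words sq do rewrite vertex_kfun // mulr_sumr.
    rewrite exchange_big.
    under eq_bigr => al _ do (under eq_bigr => q _ do rewrite mulr_sumr; rewrite exchange_big).
  over.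
  rewrite [RHS]exchange_big; apply: eq_bigr => al _ /=; rewrite [RHS]exchange_big.
  apply: eq_bigr => be _ /=.
  rewrite [X in X * _](_ : _ = Num.conj (threevertex (mxtens_index (al, be)) ga));
    last by rewrite !mxE.
  move: (threevertex _ de) => Y; rewrite threevertexE rmorph_sum mulr_suml.
  apply: eq_bigr => p _.
  rewrite rmorph_sum mulr_suml; apply: eq_bigr => q _.
  by rewrite !rmorphM /= !conjCK /v; ring.
transitivity (\sum_(v' <- words N (k + t.*2))
   (v ga (str v'))^* * vertex scupF scapF qdim r s t (kfun de) (str v')).
  by rewrite (@sum_words_addn _ _ i j (k + t.*2)) // -addnn; lia.
rewrite scups_adj ?leq_addl // scaps_vertex (sjw_wproj Wke) wproj_emb //.
set c := \prod_(l < t) _.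
transitivity (c * (Wk ^t* *m Wk) ga de); last first.
  by rewrite (emb_iso Wke) !mxE mulr_natr.
rewrite mxE (sum_idx c0) mulr_sumr; apply: eq_sum_words => x sx.
rewrite fctE /kfun -{1 2}[x]cats0 !(seg_str _ sx (erefl (size [::]))).
by rewrite !mxE /GRing.scale /= mulrCA.
Qed.

End Vertex.
End Projections.

(** * Equivariance of the three-vertex *)

Section VertexIntertwiner.
Variables (R : realType) (N : nat) (F : 'M[R[i]]_N) (G : freeOrthogonal F).
Variable (u : irreps G) (c0 : 'I_N) (hF : kac_parameter F).
Notation C := R[i].
Notation d := (irr_dim u).
Notation idx := (idx c0).
Notation str := (str c0).
Notation V := ((nat -> 'I_N) -> C^o).
Notation scups := (cups (scupF F)).
Notation gen := (fo_gen G).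

Fixpoint pairw (x y : seq 'I_N) : C :=
  match x, y with
  | a :: x', b :: y' => F a b * pairw x' y'
  | _, _ => 1
  end.

Lemma pairw_rcons x y a b : size x = size y ->
  pairw (rcons x a) (rcons y b) = pairw x y * F a b.
Proof.
elim: x y => [|c x IH] [|e y] //= => [_|[/IH ->]]; last by rewrite mulrA.
by rewrite mulr1 mul1r.
Qed.

(** Nesting pairs the last letter of [z] with the first of [z'], whence the reversal. *)
Lemma scups_str s t y z z' x (f : V) : size y = s -> size z = t -> size z' = t ->
  scups s t f (str (y ++ z ++ z' ++ x)) = pairw z (rev z') * f (str (y ++ x)).
Proof.
move=> sy; elim: t z z' x f => [|t IH] z z' x f.
  by move=> /size0nil -> /size0nil -> /=; rewrite mul1r.
case/lastP: z => [//|z a]; rewrite size_rcons => -[sz].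
case: z' => [//|b z'] [sz'].
rewrite rev_cons pairw_rcons ?size_rev ?sz ?sz' // cat_rcons catA /=.
rewrite /scupF /= /scup str_pair size_cat sy sz !ins2_at del_ins -catA IH //.
by rewrite mulrA [F _ _ * _]mulrC.
Qed.

(** Equivariance of one cup: summing over its two letters, [cup_gen] replaces two adjacent
    generators by a scalar. *)
Lemma scup_gen_word n i (f : V) a b x y : size x = i -> (size x + size y)%N = n ->
  \sum_(v <- words N n.+2) scupF F i f (str v) *: gen_word G (x ++ a :: b :: y) v =
  F a b *: \sum_(v <- words N n) f (str v) *: gen_word G (x ++ y) v.
Proof.
move=> sx sxy; have E : ((i + size y).+2 = n.+2)%N by rewrite -sx sxy.
rewrite (sum_words_pair _ E) (@sum_words_addn _ _ i (size y) n); last by rewrite -sx.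
rewrite scaler_sumr; apply: eq_sum_words => x' sx'.
rewrite scaler_sumr; apply: eq_sum_words => y' sy'.
transitivity (\sum_c \sum_e f (str (x' ++ y')) *:
  (gen_word G x x' * (F c e *: (gen a c * gen b e)) * gen_word G y y')).
  apply: eq_bigr => c _; apply: eq_bigr => e _.
  rewrite /scupF /= /scup str_pair sx' !ins2_at del_ins.
  rewrite !gen_word_cat ?sx ?sx' //= -scalerAr -scalerAl scalerA mulrC; congr (_ *: _).
  by rewrite !mulrA.
under eq_bigr do rewrite -scaler_sumr -mulr_suml -mulr_sumr.
rewrite -scaler_sumr -mulr_suml -mulr_sumr (cup_gen G hF).
by rewrite -scalerAr mulr1 -scalerAl scalerA mulrC -scalerA gen_word_cat // sx sx'.
Qed.

Lemma scups_gen_word s t n (f : V) y z z' x :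
  size y = s -> size z = t -> size z' = t -> (s + size x)%N = n ->
  \sum_(v <- words N (n + t.*2)) scups s t f (str v) *: gen_word G (y ++ z ++ z' ++ x) v =
  pairw z (rev z') *: \sum_(v <- words N n) f (str v) *: gen_word G (y ++ x) v.
Proof.
move=> sy; elim: t z z' x f => [|t IH] z z' x f.
  by move=> /size0nil -> /size0nil -> /= _; rewrite addn0 scale1r.
case/lastP: z => [//|z a]; rewrite size_rcons => -[sz].
case: z' => [//|b z'] [sz'] sx.
rewrite rev_cons pairw_rcons ?size_rev ?sz ?sz' // cat_rcons catA /=.
rewrite doubleS !addnS scup_gen_word; first last.
- by rewrite !size_cat sy sz sz' -addnn; lia.
- by rewrite size_cat sy sz.
by rewrite -catA IH // scalerA [F _ _ * _]mulrC.
Qed.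

Section Vertex.
Variables (r s t : nat).
Local Notation i := (s + t)%N.
Local Notation j := (r + t)%N.
Local Notation k := (r + s)%N.
Variables (Wi : 'M[C]_(dimn N i, d i)) (Wj : 'M[C]_(dimn N j, d j)).
Variables (Wk : 'M[C]_(dimn N k, d k)).
Hypotheses (Wie : embedding c0 Wi) (Wje : embedding c0 Wj).
Hypothesis (Wke : embedding c0 Wk).
Notation X := (threevertex c0 Wi Wj Wk).
Notation kf := (kfun c0 Wk).

Lemma kfun_str ga y : size y = k -> kf ga (str y) = Wk (idx k y) ga.
Proof. by move=> sy; rewrite /kfun -{1}[y]cats0 (seg_str _ sy (erefl (size [::]))). Qed.

Lemma emb_to_word m (W : 'M[C]_(dimn N m, d m)) x al : embedding c0 W -> size x = m ->
  \sum_(y <- words N m) W (idx m y) al *: gen_word G x y =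
  \sum_be W (idx m x) be *: irr_mx u m be al.
Proof.
move=> We sx; have /matrixP/(_ (idx m x) al) := emb_to We.
rewrite mul_scalar_entriesE mulmx_scalar_entriesE => ->.
rewrite (sum_idx c0); apply: eq_sum_words => y sy.
by rewrite gen_power_idx.
Qed.

Lemma emb_from_word m (W : 'M[C]_(dimn N m, d m)) x al : embedding c0 W -> size x = m ->
  \sum_be (W (idx m x) be)^* *: irr_mx u m al be =
  \sum_(y <- words N m) (W (idx m y) al)^* *: gen_word G y x.
Proof.
move=> We sx; have /matrixP/(_ al (idx m x)) := emb_from We.
rewrite mul_scalar_entriesE mulmx_scalar_entriesE => E.
transitivity (\sum_be (W ^t*) be (idx m x) *: irr_mx u m al be).
  by apply: eq_bigr => be _; rewrite !mxE.
rewrite -E (sum_idx c0); apply: eq_sum_words => y sy.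
by rewrite gen_power_idx // !mxE.
Qed.

Lemma kfun_gen_word ga p q : size p = i -> size q = j ->
  \sum_(v <- words N (i + j)) scups s t (kf ga) (str v) *: gen_word G (p ++ q) v =
  \sum_de scups s t (kf de) (str (p ++ q)) *: irr_mx u k de ga.
Proof.
move=> sp sq; rewrite -(cat_take_drop s p) -(cat_take_drop t q).
set y := take s p; set z := drop s p; set z' := take t q; set x := drop t q.
have sy : size y = s by rewrite size_take sp; case: ifP => //; lia.
have sz : size z = t by rewrite size_drop sp; lia.
have sz' : size z' = t by rewrite size_take sq; case: ifP => //; lia.
have sx : size x = r by rewrite size_drop sq; lia.
have -> : (i + j = k + t.*2)%N by rewrite -addnn; lia.
rewrite -!catA (scups_gen_word _ sy sz sz'); last by rewrite sx addnC.
have syx : size (y ++ x) = k by rewrite size_cat sy sx addnC.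
transitivity (pairw z (rev z') *:
  \sum_(v <- words N k) Wk (idx k v) ga *: gen_word G (y ++ x) v).
  by congr (_ *: _); apply: eq_sum_words => v sv; rewrite kfun_str.
rewrite (emb_to_word ga Wke syx) scaler_sumr; apply: eq_bigr => de _.
by rewrite scalerA scups_str // kfun_str.
Qed.

(** Verified entrywise because the cups act on functions of words: generators pass through [Wk] and
    the cups by [kfun_gen_word], and through the adjoints of [Wi] and [Wj] by [emb_from_word]. *)
Lemma threevertex_intertwiner :
  intertwiner (irr_mx u k) (tensmx (irr_mx u i) (irr_mx u j)) X.
Proof.
apply/matrixP => ab ga; case: (mxtens_indexP ab) => al be {ab}.
rewrite mul_scalar_entriesE mulmx_scalar_entriesE sum_mxtens.
transitivity (\sum_(p <- words N i) \sum_(q <- words N j)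
  ((Wi (idx i p) al)^* * (Wj (idx j q) be)^*) *:
    \sum_de scups s t (kf de) (str (p ++ q)) *: irr_mx u k de ga).
  under eq_bigr => de _ do (rewrite threevertexE scaler_suml;
    under eq_bigr => p _ do rewrite scaler_suml).
  rewrite exchange_big; apply: eq_bigr => p _ /=; rewrite exchange_big.
  apply: eq_bigr => q _; rewrite scaler_sumr; apply: eq_bigr => de _.
  by rewrite scalerA mulrA.
transitivity (\sum_(p <- words N i) \sum_(q <- words N j)
  scups s t (kf ga) (str (p ++ q)) *:
   ((\sum_al' (Wi (idx i p) al')^* *: irr_mx u i al al') *
    (\sum_be' (Wj (idx j q) be')^* *: irr_mx u j be be'))); last first.
  under [RHS]eq_bigr => al' _ do (under eq_bigr => be' _ do
   (rewrite threevertexE tensmxE scaler_suml; under eq_bigr => p _ do rewrite scaler_suml);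
   rewrite exchange_big; under eq_bigr => p _ do rewrite exchange_big).
  rewrite [RHS]exchange_big; apply: eq_bigr => p _ /=.
  rewrite [RHS]exchange_big; apply: eq_bigr => q _ /=.
  rewrite mulr_suml scaler_sumr; apply: eq_bigr => al' _.
  rewrite mulr_sumr scaler_sumr; apply: eq_bigr => be' _.
  rewrite -scalerAl -scalerAr !scalerA; congr (_ *: _).
  by ring.
transitivity (\sum_(p <- words N i) \sum_(q <- words N j)
  \sum_(p' <- words N i) \sum_(q' <- words N j)
  ((Wi (idx i p) al)^* * (Wj (idx j q) be)^*) *:
    (scups s t (kf ga) (str (p' ++ q')) *: gen_word G (p ++ q) (p' ++ q'))).
  apply: eq_sum_words => p sp; apply: eq_sum_words => q sq.
  rewrite -kfun_gen_word // sum_words_cat scaler_sumr; apply: eq_bigr => p' _.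
  by rewrite scaler_sumr.
under eq_bigr => p _ do rewrite exchange_big.
rewrite exchange_big; apply: eq_sum_words => p' sp'.
under eq_bigr => p _ do rewrite exchange_big.
rewrite exchange_big; apply: eq_sum_words => q' sq'.
rewrite (emb_from_word al Wie sp') (emb_from_word be Wje sq').
rewrite mulr_suml scaler_sumr; apply: eq_sum_words => p sp.
rewrite mulr_sumr scaler_sumr; apply: eq_sum_words => q sq.
by rewrite gen_word_cat ?sp ?sp' // -scalerAl -scalerAr !scalerA mulrC mulrA.
Qed.

End Vertex.
End VertexIntertwiner.

(** * Haar state *)

Section Haar.
Variables (R : realType) (N : nat) (F : 'M[R[i]]_N) (G : freeOrthogonal F).
Variable (u : irreps G) (c0 : 'I_N) (hF : kac_parameter F).
Variables (h : {scalar G}) (hh : haar_state h).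
Notation C := R[i].
Notation d := (irr_dim u).
Notation gen := (fo_gen G).
Notation sc := (@scalar_entries R G _ _).

(** Multiplicity one: the fusion labels are distinct, so [X] and [T] both factor through the single
    summand labelled [k], where Schur makes each a scalar. *)
Lemma intertwiner_scalar i j k (X : 'M[C]_(d i * d j, d k)) c
    (T : 'M[C]_(d k, d i * d j)) l :
  k = (maxn i j - minn i j + 2 * l)%N -> (l <= minn i j)%N ->
  intertwiner (irr_mx u k) (tensmx (irr_mx u i) (irr_mx u j)) X ->
  X ^t* *m X = c%:M -> c != 0 ->
  intertwiner (tensmx (irr_mx u i) (irr_mx u j)) (irr_mx u k) T ->
  exists tau, T = tau *: X ^t*.
Proof.
move=> kE l_le XE XX c_neq0 TE.
have [S [St Sf Si Ss]] := fusion_decomposition u i j.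
pose l0 : 'I_(minn i j).+1 := Ordinal (l_le : (l < (minn i j).+1)%N).
have labE l' : l' != l0 -> (maxn i j - minn i j + 2 * l')%N != k.
  rewrite kE -val_eqE /= => /eqP ne; apply/eqP; lia.
have XS : X = (S l0) ^t* *m (S l0 *m X).
  rewrite -[LHS]mul1mx -Ss mulmx_suml (bigD1 l0) //= big1 => [|l' ne].
    by rewrite addr0 mulmxA.
  rewrite -mulmxA (schur_neq (intertwiner_comp (St l') XE)) ?mulmx0 //.
  by rewrite eq_sym labE.
have TS : T = T *m (S l0) ^t* *m S l0.
  rewrite -[LHS]mulmx1 -Ss mulmx_sumr (bigD1 l0) //= big1 => [|l' ne].
    by rewrite addr0 mulmxA.
  by rewrite mulmxA (schur_neq (intertwiner_comp TE (Sf l'))) ?mul0mx // labE.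
have k_l0 : (maxn i j - minn i j + 2 * l0)%N = k by rewrite kE.
(* The summand is generalised first so that its dependent label can be rewritten to [k]. *)
move: (S l0) (St l0) (Sf l0) (Si l0) XS TS; rewrite k_l0 => S0 S0t S0f S0i XS TS.
have [x xE] := schur (irr_irreducible u k) (intertwiner_comp S0t XE).
have [y yE] := schur (irr_irreducible u k) (intertwiner_comp TE S0f).
have XS' : X = x *: S0 ^t* by rewrite XS xE mul_mx_scalar.
have x0 : x != 0.
  apply: contraNneq c_neq0 => x0; move: XX; rewrite XS' x0 scale0r mulmx0.
  move/matrixP/(_ (Ordinal (irr_dim_gt0 u k)) (Ordinal (irr_dim_gt0 u k))).
  by rewrite !mxE eqxx mulr1n => <-.
exists (y / x^*); rewrite TS yE mul_scalar_mx XS'.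
have -> : (x *: S0 ^t*) ^t* = x^* *: S0.
  by apply/matrixP => a b; rewrite !mxE rmorphM /= conjCK.
by rewrite scalerA divfK // conjC_eq0.
Qed.

(** Half of the unitarity of the entrywise conjugate of [v], which for noncommuting entries is a
    condition different from unitarity of [v]. It keeps modular weights out of the orthogonality
    relations. *)
Definition conj_unitary n (v : 'M[G]_n) :=
  forall a c, \sum_b cstar (v a b) * v c b = (a == c)%:R.

(** The star reverses products, so the sum for [v] sits between the factors of [w] and collapses
    first. *)
Lemma conj_unitary_tens m n (v : 'M[G]_m) (w : 'M[G]_n) :
  conj_unitary v -> conj_unitary w -> conj_unitary (tensmx v w).
Proof.
move=> vU wU a c; case: (mxtens_indexP a) => a1 a2; case: (mxtens_indexP c) => c1 c2.
transitivity (\sum_b cstar (w a2 b) * (\sum_e cstar (v a1 e) * v c1 e) * w c2 b).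
  rewrite sum_mxtens exchange_big; apply: eq_bigr => b _.
  rewrite mulr_sumr mulr_suml; apply: eq_bigr => e _.
  by rewrite !tensmxE cstarM !mulrA.
rewrite vU (inj_eq (can_inj (@mxtens_indexK m n))) xpair_eqE.
case: (a1 == c1); first by under eq_bigr do rewrite mulr1; rewrite wU.
by rewrite big1 // => b _; rewrite mulr0 mul0r.
Qed.

Lemma conj_unitary_sub m n (v : 'M[G]_m) (w : 'M[G]_n) S :
  conj_unitary w -> intertwiner w v S -> intertwiner v w (S ^t*) ->
  S *m S ^t* = 1%:M -> conj_unitary v.
Proof.
move=> wU SE SE' SS a c; set z := sc S *m w.
have vE : v = z *m sc (S ^t*).
  by rewrite /z SE -mulmxA -scalar_entriesM SS scalar_entries1 mulmx1.
have zE y x : z y x = \sum_b S b x *: v y b by rewrite /z SE mulmx_scalar_entriesE.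
transitivity (\sum_x cstar (z a x) * z c x).
  under eq_bigr => b _ do rewrite {1}vE mulmx_scalar_entriesE cstar_sum mulr_suml.
  rewrite exchange_big; apply: eq_bigr => x _.
  rewrite [z c x]zE mulr_sumr; apply: eq_bigr => b _.
  by rewrite cstarZ -scalerAl -scalerAr !mxE /= conjCK.
transitivity (\sum_y \sum_y' ((S a y)^* * S c y') *: \sum_x cstar (w y x) * w y' x).
  under eq_bigr => x _ do rewrite /z !mul_scalar_entriesE cstar_sum mulr_suml.
  rewrite exchange_big; apply: eq_bigr => y _.
  under eq_bigr => x _ do rewrite mulr_sumr.
  rewrite exchange_big; apply: eq_bigr => y' _; rewrite scaler_sumr.
  by apply: eq_bigr => x _; rewrite cstarZ -scalerAl -scalerAr scalerA.
transitivity ((S *m S ^t*) c a *: (1 : G)).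
  rewrite mxE scaler_suml; apply: eq_bigr => y _.
  rewrite (bigD1 y) //= [X in _ + X]big1 => [|y' ne]; last first.
    by rewrite wU eq_sym (negPf ne) scaler0.
  by rewrite wU eqxx addr0 !mxE mulrC.
by rewrite SS mxE scaler_nat eq_sym.
Qed.

Lemma irr_conj_unitary k : conj_unitary (irr_mx u k).
Proof.
suff [] : conj_unitary (irr_mx u k) /\ conj_unitary (irr_mx u k.+1) by [].
have genU : conj_unitary gen.
  move=> a c; have [_ /matrixP/(_ a c)] := gen_unitary_bar G hF.
  rewrite [RHS]mxE => <-; rewrite mxE; apply: eq_bigr => b _.
  by rewrite !mxE.
elim: k => [|k [_ IH]]; split=> //.
- have [S [S1 S2 SE]] := irr_trivial u.
  apply: (@conj_unitary_sub _ _ _ (1%:M : 'M[G]_1) (S ^t*)).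
  + by move=> a c; rewrite big_ord1 !ord1 !mxE eqxx cstar1 mulr1.
  + exact: intertwiner_unitary.
  + by rewrite trmxCK.
  + by rewrite trmxCK.
- have [S [S1 S2 SE]] := irr_fundamental u.
  apply: (@conj_unitary_sub _ _ _ gen (S ^t*) genU).
  + exact: intertwiner_unitary.
  + by rewrite trmxCK.
  + by rewrite trmxCK.
have [Sp [_ [[Spi Spt Spf] _]]] := fundamental_split u k.
exact: conj_unitary_sub (conj_unitary_tens genU IH) Spt Spf Spi.
Qed.

(** Left invariance applied to the coproduct of [cstar (v al b) * w c e] says that [v' H w = H],
    with [H] the matrix of Haar values and [v'] the adjoint of [v]; multiply by [v] on the left. *)
Lemma haar_mul n (w : 'M[G]_n) k al c :
  (forall a b, fo_coprod G (w a b) = \sum_e fo_inl G (w a e) * fo_inr G (w e b)) ->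
  intertwiner w (irr_mx u k) (\matrix_(a, e) h (cstar (irr_mx u k al a) * w c e)).
Proof.
move=> wD; have [[v1 v2] vD] := irr_rep u k.
set v := irr_mx u k in v1 v2 vD *; set H := \matrix_(a, e) _.
have [E [_ Etens] Einv] := haar_left hh.
have [[starl starr comm _] _ _] := fo_tensorP G.
have key : adjoint_mx v *m sc H *m w = sc H.
  apply/matrixP => b e.
  transitivity (E (fo_coprod G (cstar (v al b) * w c e))); last by rewrite Einv !mxE.
  rewrite rmorphM /= fo_coprod_star vD wD cstar_sum mulr_suml raddf_sum /=.
  transitivity (\sum_a \sum_f H a f *: (cstar (v a b) * w f e)).
    rewrite exchange_big mxE; apply: eq_bigr => f _.
    rewrite mulmx_scalar_entriesE mulr_suml; apply: eq_bigr => a _.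
    by rewrite -scalerAl !mxE.
  apply: eq_bigr => a _; rewrite mulr_sumr raddf_sum; apply: eq_bigr => f _ /=.
  rewrite cstarM -starl -starr -comm mulrA -[_ * fo_inl G (w c f)]mulrA -comm.
  by rewrite mulrA -rmorphM -mulrA -rmorphM Etens mxE.
rewrite /intertwiner -[LHS]mul1mx -v2 -!mulmxA; congr (_ *m _).
by rewrite mulmxA key.
Qed.

(** By Schur the matrix of values is a scalar, whose trace [irr_conj_unitary] computes. *)
Lemma haar_orth k al a ga b :
  h (cstar (irr_mx u k al a) * irr_mx u k ga b) =
  (al == ga)%:R * (a == b)%:R / (d k)%:R.
Proof.
have d0 : (d k)%:R != 0 :> C by rewrite pnatr_eq0 -lt0n irr_dim_gt0.
have [c cE] := schur (irr_irreducible u k) (haar_mul al ga (irr_rep u k).2).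
have cd : c * (d k)%:R = (al == ga)%:R.
  rewrite mulr_natr -mxtrace_scalar -cE.
  transitivity (h (\sum_a cstar (irr_mx u k al a) * irr_mx u k ga a)).
    by rewrite raddf_sum; apply: eq_bigr => e _; rewrite mxE.
  by rewrite irr_conj_unitary; case: (al == ga); rewrite ?raddf0 ?(haar1 hh).
have /matrixP/(_ a b) := cE; rewrite !mxE => ->.
by rewrite -cd mulrAC mulfK // mulr_natr.
Qed.

(** For fixed row indices the values form an intertwiner, hence a multiple [tau] of [X']. *)
Lemma haar_vertex i j k (X : 'M[C]_(d i * d j, d k)) th l :
  k = (maxn i j - minn i j + 2 * l)%N -> (l <= minn i j)%N ->
  intertwiner (irr_mx u k) (tensmx (irr_mx u i) (irr_mx u j)) X ->
  X ^t* *m X = th%:M -> th != 0 ->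
  forall al a be b ga c,
  h (cstar (irr_mx u k al a) * (irr_mx u i be b * irr_mx u j ga c)) =
  X (mxtens_index (be, ga)) al * (X (mxtens_index (b, c)) a)^* / ((d k)%:R * th).
Proof.
move=> kE l_le XE XX th0 al a be b ga c.
have d0 : (d k)%:R != 0 :> C by rewrite pnatr_eq0 -lt0n irr_dim_gt0.
set w := tensmx (irr_mx u i) (irr_mx u j) in XE *.
have wD x y : fo_coprod G (w x y) = \sum_e fo_inl G (w x e) * fo_inr G (w e y).
  have [[_ _ comm _] _ _] := fo_tensorP G.
  rewrite mxE rmorphM /= !(irr_rep u _).2 sum_mxtens mulr_suml.
  apply: eq_bigr => e _; rewrite mulr_sumr; apply: eq_bigr => f _.
  rewrite !mxE !mxtens_indexK !rmorphM !mulrA; congr (_ * _).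
  by rewrite -!mulrA comm.
set x := mxtens_index (be, ga); set y := mxtens_index (b, c).
have -> : irr_mx u i be b * irr_mx u j ga c = w x y by rewrite tensmxE.
have HE := haar_mul al x wD.
have [tau tauE] := intertwiner_scalar kE l_le XE XX th0 HE.
(* Multiplying by [X] on the right exposes [tau * th]; pushing [X] through the representations
   reduces the diagonal entry at [al] to [haar_orth]. *)
have tauth : tau * th = X x al / (d k)%:R.
  have /(congr1 (fun M => M *m X)) := tauE.
  rewrite -scalemxAl XX scale_scalar_mx => /matrixP/(_ al al).
  rewrite [RHS]mxE eqxx mulr1n => <-; rewrite mxE.
  transitivity (h (cstar (irr_mx u k al al) * (w *m sc X) x al)).
    rewrite mulmx_scalar_entriesE mulr_sumr raddf_sum; apply: eq_bigr => e _ /=.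
    by rewrite mxE -scalerAr linearZ /= mulrC.
  rewrite -XE mul_scalar_entriesE mulr_sumr raddf_sum (bigD1 al) //= big1 => [|e ne].
    by rewrite addr0 -scalerAr linearZ /= haar_orth !eqxx !mul1r.
  by rewrite -scalerAr linearZ /= haar_orth eq_sym (negPf ne) !mul0r mulr0.
have /matrixP/(_ a y) := tauE; rewrite !mxE => ->.
rewrite (_ : tau = X x al / (d k)%:R / th); last by rewrite -tauth mulfK.
by field; rewrite th0 d0.
Qed.

End Haar.

(** * Norm of the product *)

Local Open Scope classical_set_scope.
Local Open Scope ring_scope.
Local Open Scope complex_scope.
Local Open Scope sesquilinear_scope.

Section QuantumIntegers.
Variable R : realType.
Implicit Types q : R.

Lemma qint0 q : qint q 0 = 0.
Proof. by rewrite /qint; case: eqP => // _; rewrite !expr0 invr1 subrr mul0r. Qed.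

Lemma qint1 q : 0 < q <= 1 -> qint q 1 = 1.
Proof.
move=> /andP[q0 q1]; rewrite /qint; case: eqVneq => // q_neq1.
rewrite !expr1 divff // subr_eq0; apply/eqP => e.
have : q * q = 1 by rewrite -{1}e mulVf ?gt_eqF.
have q_lt1 : q < 1 by rewrite lt_neqAle q_neq1.
by move=> qq; move: (mulr_ilt1 (ltW q0) (ltW q0) q_lt1 q_lt1); rewrite qq ltxx.
Qed.

Lemma qintSS N q m : (2 <= N)%N -> quantum_parameter N q ->
  qint q m.+2 = N%:R * qint q m.+1 - qint q m.
Proof.
rewrite /quantum_parameter => N2; case: ltnP => [N3 [/andP[q0 q1] ->]|N2' ->].
  rewrite /qint lt_eqF //.
  have x0 : q ^+ m != 0 by rewrite expf_neq0 // gt_eqF.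
  rewrite mulrA -mulrBl; congr (_ / _); rewrite !exprS.
  by field; rewrite x0 gt_eqF.
have -> : N = 2%N by lia.
by rewrite /qint eqxx -natrM -natrB; [congr (_%:R)|]; lia.
Qed.

Lemma quantum_parameter_gt0 N q : quantum_parameter N q -> 0 < q <= 1.
Proof.
rewrite /quantum_parameter; case: ltnP => [_ [/andP[-> /ltW ->]]|_ ->] //.
by rewrite ltr01 lexx.
Qed.

Lemma qfactS q m : qfact q m.+1 = qfact q m * qint q m.+1.
Proof. by rewrite /qfact big_nat_recr. Qed.

Lemma theta_vertex_ratio q r s t : (forall m, qint q m.+1 != 0) ->
  theta q r s t = qint q (r + s).+1 * \prod_(l < t) vertex_ratio (qint q) r s l.
Proof.
move=> q0.
have f0 m : qfact q m != 0.
  by elim: m => [|m IH]; rewrite ?qfactS ?mulf_neq0 // /qfact big_geq ?oner_eq0.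
elim: t => [|t IH].
  rewrite big_ord0 mulr1 /theta !addn0 addn1 qfactS {4}/qfact big_geq //.
  by field; rewrite !f0.
rewrite big_ord_recr mulrA -IH /theta /vertex_ratio /= !(addnS, addn1, addn0) !qfactS.
by field; rewrite !f0 !q0.
Qed.

End QuantumIntegers.

(** * The estimate of the trilinear Haar form *)

Section Bound.
Variables (R : realType) (N : nat) (F : 'M[R[i]]_N) (G : freeOrthogonal F).
Variable (u : irreps G) (c0 : 'I_N) (hF : kac_parameter F).
Variables (h : {scalar G}) (hh : haar_state h).
Notation C := R[i].
Notation d := (irr_dim u).
Notation idx := (idx c0).

(** The columns of a tensor power of the unitary [F] are orthonormal. *)
Lemma pairw_orthonormal n x y : size x = n -> size y = n ->
  \sum_(z <- words N n) pairw F z x * (pairw F z y)^* = (x == y)%:R.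
Proof.
elim: n x y => [|n IH] [|b x] [|e y] //; first by rewrite sum_words0 mul1r rmorph1.
move=> [sx] [sy]; rewrite sum_wordsS /= eqseq_cons -mulnb natrM -(IH x y) //.
have <- : \sum_a F a b * (F a e)^* = (b == e)%:R.
  rewrite eq_sym; have /matrixP/(_ e b) := (Fstar hF).1; rewrite [RHS]mxE => <-.
  by rewrite mxE; apply: eq_bigr => a _; rewrite !mxE mulrC.
rewrite mulr_suml; apply: eq_bigr => a _; rewrite mulr_sumr.
by apply: eq_bigr => z _; rewrite rmorphM /= mulrACA.
Qed.

Section Trivalent.
Variables (r s t : nat).
Local Notation i := (s + t)%N.
Local Notation j := (r + t)%N.
Local Notation k := (r + s)%N.
Variables (Wi : 'M[C]_(dimn N i, d i)) (Wj : 'M[C]_(dimn N j, d j)).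
Variables (Wk : 'M[C]_(dimn N k, d k)).
Hypotheses (Wie : embedding c0 Wi) (Wje : embedding c0 Wj).
Hypothesis (Wke : embedding c0 Wk).
Notation X := (threevertex c0 Wi Wj Wk).

Definition leg_i al (y z : seq 'I_N) := (Wi (idx i (y ++ z)) al)^*.
Definition leg_k ga (y x : seq 'I_N) := Wk (idx k (y ++ x)) ga.
(** The cups are absorbed into this leg, so that [leg_i] and [leg_j] meet along one common bundle of
    [t] strands. *)
Definition leg_j be (z x : seq 'I_N) := \sum_(z' <- words N t)
  pairw F z (rev z') * (Wj (idx j (z' ++ x)) be)^*.

Lemma emb_orthonormal m (W : 'M[C]_(dimn N m, d m)) al be : embedding c0 W ->
  \sum_(x <- words N m) (W (idx m x) al)^* * W (idx m x) be = (al == be)%:R.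
Proof.
move=> We; have /matrixP/(_ al be) := emb_iso We; rewrite [RHS]mxE => <-.
by rewrite mxE (sum_idx c0); apply: eq_bigr => x _; rewrite !mxE.
Qed.

Lemma leg_i_orthonormal : orthonormal2 (words N s) (words N t) leg_i.
Proof.
move=> al be; rewrite -(emb_orthonormal al be Wie) sum_words_cat.
by do 2![apply: eq_bigr => ? _]; rewrite /leg_i conjCK.
Qed.

Lemma leg_k_orthonormal : orthonormal2 (words N s) (words N r) leg_k.
Proof.
move=> al be; rewrite eq_sym -(emb_orthonormal be al Wke).
rewrite [RHS](@sum_words_addn _ _ s r) ?(addnC s) //.
by do 2![apply: eq_bigr => ? _]; rewrite mulrC.
Qed.

Lemma leg_j_orthonormal : orthonormal2 (words N t) (words N r) leg_j.
Proof.
move=> al be; rewrite -(emb_orthonormal al be Wje).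
rewrite [RHS](@sum_words_addn _ _ t r) ?(addnC t) // exchange_big [RHS]exchange_big.
apply: eq_bigr => x _ /=.
transitivity (\sum_(z' <- words N t) \sum_(z'' <- words N t)
  (z' == z'')%:R * ((Wj (idx j (z' ++ x)) al)^* * Wj (idx j (z'' ++ x)) be)).
  rewrite /leg_j; under eq_bigr => z _ do
    (rewrite mulr_suml rmorph_sum; under eq_bigr => z' _ do rewrite mulr_sumr).
  rewrite exchange_big; apply: eq_sum_words => z' sz'.
  rewrite exchange_big; apply: eq_sum_words => z'' sz''.
  rewrite -(inj_eq (can_inj revK)) -(pairw_orthonormal (n := t)) ?size_rev //.
  rewrite mulr_suml; apply: eq_bigr => z _.
  by rewrite rmorphM /= conjCK mulrACA.
by apply: eq_sum_words => z' sz'; rewrite sum_words_delta.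
Qed.

Lemma threevertex_trivalent al be ga : X (mxtens_index (al, be)) ga =
  trivalent (words N s) (words N t) (words N r) leg_i leg_j leg_k al be ga.
Proof.
rewrite threevertexE sum_words_cat; apply: eq_sum_words => y sy.
transitivity (\sum_(z <- words N t) \sum_(x <- words N r) leg_i al y z * leg_j be z x
  * leg_k ga y x); last first.
  by rewrite exchange_big; apply: eq_bigr => x _; rewrite mulr_suml.
apply: eq_sum_words => z sz.
rewrite (@sum_words_addn _ _ t r) ?(addnC t) // exchange_big.
apply: eq_sum_words => x sx; rewrite /leg_j mulr_sumr mulr_suml.
apply: eq_sum_words => z' sz'.
rewrite -catA scups_str // kfun_str ?size_cat ?sy ?sx 1?addnC //.
by rewrite /leg_i /leg_k; ring.
Qed.

Lemma haar_product_bound (A : 'I_(d i) * 'I_(d i) -> C) (B : 'I_(d j) * 'I_(d j) -> C)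
    (D : 'I_(d k) * 'I_(d k) -> C) :
  let th := \prod_(l < t) vertex_ratio (qdim u) r s l in th != 0 ->
  `|h (cstar (\sum_m D m *: irr_mx u k m.1 m.2) *
      ((\sum_m A m *: irr_mx u i m.1 m.2) * (\sum_m B m *: irr_mx u j m.1 m.2)))|
    ^+ 2 * `|(d k)%:R * th| ^+ 2 <=
  (\sum_m `|A m| ^+ 2) * (\sum_m `|B m| ^+ 2) * (\sum_m `|D m| ^+ 2).
Proof.
move=> th th0; have d0 : (d k)%:R != 0 :> C by rewrite pnatr_eq0 -lt0n irr_dim_gt0.
(* The summand index is [minn r s], since [r + s = |r - s| + 2 min(r, s)] and the lowest fusion
   label is [|i - j| = |r - s|]. *)
have hV := @haar_vertex _ _ _ _ u hF h hh i j k X th (minn r s) _ _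
  (threevertex_intertwiner hF Wie Wje Wke) (threevertex_gram hF Wie Wje Wke) th0.
(* The star is antilinear, so [D] enters the form conjugated. *)
have -> : \sum_m `|D m| ^+ 2 = \sum_m `|(D m)^*| ^+ 2.
  by apply: eq_bigr => m _; rewrite norm_conjC.
apply: le_trans (trivalent_bound2 leg_i_orthonormal leg_j_orthonormal leg_k_orthonormal
  A B (fun m => (D m)^*)).
rewrite -exprMn -normrM le_eqVlt; apply/orP; left; apply/eqP; congr (`|_| ^+ 2).
rewrite cstar_sum mulr_suml raddf_sum mulr_suml /=.
under eq_bigr => m _ do
  (rewrite mulr_suml mulr_sumr raddf_sum mulr_suml /=;
   under eq_bigr => a _ do rewrite mulr_sumr mulr_sumr raddf_sum mulr_suml /=).
rewrite exchange_big; apply: eq_bigr => a _; rewrite exchange_big.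
apply: eq_bigr => b _; apply: eq_bigr => m _.
rewrite cstarZ -![in LHS](scalerAl, scalerAr) ![in LHS]linearZ /= hV.
- by rewrite -!threevertex_trivalent; field; rewrite d0 th0.
- lia.
- lia.
Qed.

End Trivalent.

(** By [haar_orth] the coefficients of [u^k] are orthogonal with squared norm [1 / d_k]; this is the
    source of the dimensions in [crst]. *)
Lemma norm2_coeff k (A : 'I_(d k) * 'I_(d k) -> C) :
  let a := \sum_m A m *: irr_mx u k m.1 m.2 in
  h (cstar a * a) * (d k)%:R = \sum_m `|A m| ^+ 2.
Proof.
have d0 : (d k)%:R != 0 :> C by rewrite pnatr_eq0 -lt0n irr_dim_gt0.
move=> a; rewrite /a cstar_sum mulr_suml raddf_sum mulr_suml; apply: eq_bigr => m _ /=.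
rewrite mulr_sumr raddf_sum mulr_suml (bigD1 m) //= big1 => [|m' ne].
  rewrite cstarZ -scalerAl -scalerAr !linearZ /= (haar_orth hF hh) !eqxx addr0.
  by rewrite normCK !mul1r mulrA mulfVK // mulrC.
rewrite cstarZ -scalerAl -scalerAr !linearZ /= (haar_orth hF hh) -natrM mulnb.
rewrite (_ : _ && _ = false) ?mul0r ?mulr0 ?mul0r //.
by rewrite -xpair_eqE -!surjective_pairing eq_sym; apply: negbTE.
Qed.

Lemma coeff_spaceP k x : coeff_space u k x ->
  exists A : 'I_(d k) * 'I_(d k) -> C, x = \sum_m A m *: irr_mx u k m.1 m.2.
Proof.
by case=> c ->; exists (fun m => c m.1 m.2); rewrite pair_big.
Qed.

End Bound.

(** * Comparison of dimensions with quantum integers *)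

Section Constants.
Variables (R : realType) (N : nat) (F : 'M[R[i]]_N) (G : freeOrthogonal F).
Variable (u : irreps G).
Variables (q : R) (hN : (2 <= N)%N) (hq : quantum_parameter N q).
Notation C := R[i].
Notation d := (irr_dim u).

Lemma qint_dim m : qint q m.+1 = (d m)%:R.
Proof.
suff [] : qint q m.+1 = (d m)%:R /\ qint q m.+2 = (d m.+1)%:R by [].
have q1 : qint q 1 = 1 by rewrite qint1 // (quantum_parameter_gt0 hq).
elim: m => [|m [IH IH1]].
  by rewrite (qintSS _ hN hq) q1 qint0 irr_dim0 irr_dim1 mulr1 subr0.
split=> //; rewrite (qintSS _ hN hq) IH IH1 -natrM -irr_dimS natrD.
by rewrite addrK.
Qed.

Lemma qint_neq0 m : qint q m.+1 != 0.
Proof. by rewrite qint_dim pnatr_eq0 -lt0n irr_dim_gt0. Qed.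

Lemma theta_gt0 r s t : 0 < theta q r s t.
Proof.
rewrite theta_vertex_ratio; last exact: qint_neq0.
have D0 m : 0 < qint q m.+1 by rewrite qint_dim ltr0n irr_dim_gt0.
rewrite mulr_gt0 // prodr_gt0 // => l _.
by rewrite /vertex_ratio divr_gt0 ?mulr_gt0.
Qed.

Lemma dim_vertex_ratio r s t :
  (d (r + s))%:R * \prod_(l < t) vertex_ratio (qdim u) r s l = (theta q r s t)%:C.
Proof.
have qE m : qdim u m = (qint q m)%:C.
  by case: m => [|m]; rewrite ?qint0 ?qint_dim ?rmorph0 ?rmorph_nat.
rewrite theta_vertex_ratio; last exact: qint_neq0.
rewrite rmorphM rmorph_prod qint_dim rmorph_nat; congr (_ * _).
by apply: eq_bigr => l _; rewrite /vertex_ratio !qE -!rmorphM -fmorphV -rmorphM.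
Qed.

Lemma crst_ge0 r s t : 0 <= crst q d r s t.
Proof. by rewrite divr_ge0 ?sqrtr_ge0 // ltW ?theta_gt0. Qed.

Lemma crst_sq r s t : (crst q d r s t) ^+ 2 * (theta q r s t) ^+ 2 =
  (d (r + s))%:R * (d (r + t))%:R * (d (s + t))%:R.
Proof.
by rewrite -exprMn divfK ?gt_eqF ?theta_gt0 // sqr_sqrtr.
Qed.

End Constants.

Lemma crst_dim (R : realType) (q : R) (d d' : nat -> nat) r s t :
  d =1 d' -> crst q d r s t = crst q d' r s t.
Proof. by move=> dd'; rewrite /crst !dd'. Qed.

(** The initial values [1], [N] and the recursion [irr_dimS] involve only [N]. *)
Lemma irr_dim_unique (R : realType) N (F F' : 'M[R[i]]_N) (G : freeOrthogonal F)
  (G' : freeOrthogonal F') (u : irreps G) (u' : irreps G') : irr_dim u =1 irr_dim u'.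
Proof.
move=> k.
suff [] : irr_dim u k = irr_dim u' k /\ irr_dim u k.+1 = irr_dim u' k.+1 by [].
elim: k => [|k [IH IH1]]; first by rewrite !irr_dim0 !irr_dim1.
split=> //; apply/eqP; rewrite -(eqn_add2r (irr_dim u k)) irr_dimS.
by rewrite IH irr_dimS IH1.
Qed.

Theorem proposition2p2 (R : realType) (N : nat) (hN : (2 <= N)%N)
    (q : R) (hq : quantum_parameter N q)
    (F : 'M[R[i]]_N) (hF : kac_parameter F)
    (G : freeOrthogonal F) (u : irreps G)
    (h : {scalar G}) (hh : haar_state h) (L2 : gns h)
    (Pi : nat -> L2 -> L2)
    (hPi : forall k,
       orthogonal_projection (gns_map L2 @` coeff_space u k) (Pi k)) :
  (forall i j k r s t : nat,
     (i, j, k) = ((s + t)%N, (r + t)%N, (r + s)%N) ->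
     forall a b : G, coeff_space u i a -> coeff_space u j b ->
       `|Pi k (gns_map L2 (a * b))| <=
         (crst q (irr_dim u) r s t)%:C * norm2 h a * norm2 h b) /\
  (forall r s t : nat,
     [/\ crst q (irr_dim u) r s t = crst q (irr_dim u) s r t,
         crst q (irr_dim u) r s t = crst q (irr_dim u) r t s
       & forall (F' : 'M[R[i]]_N), kac_parameter F' ->
         forall (G' : freeOrthogonal F') (u' : irreps G'),
           crst q (irr_dim u) r s t = crst q (irr_dim u') r s t]).
Proof.
split; last first.
  move=> r s t; split.
  - rewrite /crst /theta [(s + r)%N]addnC.
    by congr (Num.sqrt _ / (_ / _)); ring.
  - rewrite /crst /theta [(t + s)%N]addnC [(r + t + s)%N]addnAC.
    by congr (Num.sqrt _ / (_ / _)); ring.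
  - by move=> F' _ G' u'; apply: crst_dim; exact: irr_dim_unique.
move=> i j k r s t [-> -> ->] {i j k} a b aV bV.
have c0 : 'I_N by exists 0%N; apply: leq_trans hN.
have [Wi Wie] := embedding_exists u c0 hF (s + t).
have [Wj Wje] := embedding_exists u c0 hF (r + t).
have [Wk Wke] := embedding_exists u c0 hF (r + s).
have [[c cV cE] orth] := hPi (r + s)%N (gns_map L2 (a * b)).
set x := `|_|; have x0 : 0 <= x by exact: normr_ge0.
have na0 y : 0 <= norm2 h y by rewrite sqrtC_ge0; exact: haar_ge0 hh y.
have na2 y : norm2 h y ^+ 2 = h (cstar y * y) by rewrite sqrtCK.
have xc : x ^+ 2 = h (cstar c * c) by rewrite /x -cE -gns_norm gns_mapE.
(* The difference of [ab] and its projection [c] is orthogonal to [c] itself. *)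
have xab : x ^+ 2 = h (cstar c * (a * b)).
  rewrite -(gns_mapE L2) cE /x -gns_norm; apply/esym/eqP; rewrite -subr_eq0.
  by rewrite -linearBl; apply/eqP/orth; exists c.
have [A aE] := coeff_spaceP aV; have [B bE] := coeff_spaceP bV.
have [D cE'] := coeff_spaceP cV.
set th := \prod_(l < t) vertex_ratio (qdim u) r s l.
have dth : (irr_dim u (r + s))%:R * th = (theta q r s t)%:C.
  exact: dim_vertex_ratio.
have theta0 : 0 < (theta q r s t)%:C :> R[i].
  by rewrite ltcR; exact: (theta_gt0 u).
have th0 : th != 0.
  by apply: contraTneq theta0 => th0; rewrite -dth th0 mulr0 ltxx.
have := haar_product_bound hF hh Wie Wje Wke A B D th0.
rewrite -/th dth -aE -bE -cE' -xab.
rewrite -(norm2_coeff hF hh A) -(norm2_coeff hF hh B) -(norm2_coeff hF hh D).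
rewrite -aE -bE -cE' -xc -!na2 normrX !ger0_norm ?(ltW theta0) // => bound.
set K := (crst q (irr_dim u) r s t)%:C.
have K0 : 0 <= K by rewrite lecR; exact: crst_ge0.
have K2 : K ^+ 2 * (theta q r s t)%:C ^+ 2 =
    (irr_dim u (r + s))%:R * (irr_dim u (r + t))%:R * (irr_dim u (s + t))%:R.
  by rewrite /K -!rmorphXn -rmorphM (crst_sq u hN hq) !rmorphM /= !rmorph_nat.
have rhs0 : 0 <= K * norm2 h a * norm2 h b by rewrite !mulr_ge0.
(* The bound reads [x^4 Theta^2 <= d_i d_j d_k |a|^2 |b|^2 x^2]; for [x > 0] the goal is squared and
   multiplied by [x^2 Theta^2] to match it. *)
have [->//|x_neq0] := eqVneq x 0.
have x_gt0 : 0 < x by rewrite lt_def x_neq0.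
rewrite -(@ler_pXn2r _ 2) ?nnegrE //.
rewrite -(ler_pM2r (exprn_gt0 2 x_gt0)) -(ler_pM2r (exprn_gt0 2 theta0)).
apply: le_trans (le_trans _ bound) _; first by rewrite expr2.
rewrite le_eqVlt; apply/orP; left; apply/eqP.
rewrite !exprMn; ring: K2.
Qed.
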